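(* Let $f\in C^1(\mathbb{R})$ and $M>0$, and set $G(u)=\int_u^M f(\sigma)\,d\sigma$. Assume that $f$ is odd and that $G\ge 0=G(\pm M)$ in $\mathbb{R}$ and $G>0$ in $(-M,M)$. Let $2m\ge 2$ be an even integer. If $u$ is a bounded solution of $-\Delta u=f(u)$ in $\mathbb{R}^{2m}$ that vanishes on the Simons cone $\mathcal{C}=\{s=t\}$, then $$|u(x)|\le |u_0(\operatorname{dist}(x,\mathcal{C}))|=\left|u_0\left(\frac{s-t}{\sqrt2}\right)\right|\qquad\text{for all } x\in\mathbb{R}^{2m},$$ where $\operatorname{dist}(\cdot,\mathcal{C})$ denotes the distance to the Simons cone. In addition, the function $u_0((s-t)/\sqrt2)$ is a supersolution of $-\Delta u=f(u)$ in the set $\mathcal{O}=\{s>t\}$.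
   Context: For $x=(x_1,\dots,x_{2m})\in\mathbb{R}^{2m}$ set $s=\sqrt{x_1^2+\cdots+x_m^2}\ge 0$ and $t=\sqrt{x_{m+1}^2+\cdots+x_{2m}^2}\ge 0$; the Simons cone is $\mathcal{C}=\{x\in\mathbb{R}^{2m}:s=t\}$. Bounded solutions of $-\Delta u=f(u)$ in $\mathbb{R}^{2m}$ with $f\in C^1$ are classical (of class $C^2$). Under the stated assumptions on $G$ there is an increasing solution of the one-dimensional equation taking values onto $(-M,M)$, unique up to translations; $u_0$ denotes the one vanishing at the origin. That is, $u_0\in C^2(\mathbb{R})$ is the unique function mapping $\mathbb{R}$ onto $(-M,M)$ with $u_0(0)=0$, $\dot u_0>0$ in $\mathbb{R}$, and $-\ddot u_0=f(u_0)$ in $\mathbb{R}$. Supersolution is understood in the weak sense: a locally Lipschitz function $v$ is a supersolution of $-\Delta u=f(u)$ in an open set $\mathcal{O}$ if $\int_{\mathcal{O}}\nabla v\cdot\nabla\varphi\,dx\ge\int_{\mathcal{O}}f(v)\varphi\,dx$ for all nonnegative $\varphi\in C_c^\infty(\mathcal{O})$. *)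

(* Defs.v *)
From HB Require Import structures.
From mathcomp Require Import all_boot all_order all_algebra.
From mathcomp Require Import all_classical all_reals all_analysis.

Set Implicit Arguments.
Unset Strict Implicit.
Unset Printing Implicit Defensive.

Import Order.TTheory GRing.Theory Num.Theory.
Import numFieldNormedType.Exports.

Local Open Scope ring_scope.
Local Open Scope classical_set_scope.

Section one_variable.
Variable R : realType.

Definition C1_fun (f : R -> R) : Prop :=
  (forall x, derivable f x 1) /\ continuous f^`().

Definition C2_fun (f : R -> R) : Prop :=
  (forall x, derivable f x 1) /\ C1_fun f^`().

(* The integral from a to b, with the usual sign convention when b < a. *)
Definition oriented_integral (f : R -> R) (a b : R) : R :=
  if a <= b then \int[lebesgue_measure]_(x in `[a, b]) f x
  else - \int[lebesgue_measure]_(x in `[b, a]) f x.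

Definition potential (f : R -> R) (M u : R) : R := oriented_integral f u M.

Definition layer_solution (f : R -> R) (M : R) (u0 : R -> R) : Prop :=
  [/\ C2_fun u0, range u0 = `]- M, M[%classic, u0 0 = 0,
      forall y, 0 < u0^`()%classic y
    & forall y, - u0^`(2)%classic y = f (u0 y)].

End one_variable.

(* The norm of 'rV[R]_n in the library is the sup norm, which yields the usual
   topology and the usual notion of local Lipschitz continuity; the Euclidean
   norm is needed for distances. *)
Section several_variables.
Variables (R : realType) (n : nat).
Implicit Types (u v phi : 'rV[R]_n -> R) (O A : set 'rV[R]_n).

Definition euclid_norm (x : 'rV[R]_n) : R :=
  Num.sqrt (\sum_(i < n) x ord0 i ^+ 2).

Definition euclid_dist (x : 'rV[R]_n) A : R :=
  inf [set euclid_norm (x - y) | y in A].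

Definition partial (i : 'I_n) u : 'rV[R]_n -> R := 'D_(delta_mx ord0 i) u.

Fixpoint class_C (k : nat) u : Prop :=
  continuous u /\
  match k with
  | 0 => True
  | k'.+1 => forall i : 'I_n,
      (forall x, derivable u x (delta_mx ord0 i)) /\ class_C k' (partial i u)
  end.

Definition laplacian u (x : 'rV[R]_n) : R :=
  \sum_(i < n) partial i (partial i u) x.

Definition bounded_solution (f : R -> R) u : Prop :=
  [/\ class_C 2 u, exists K : R, forall x, `|u x| <= K
    & forall x, - laplacian u x = f (u x)].

Definition test_function O phi : Prop :=
  [/\ forall k, class_C k phi,
      compact (closure [set x | phi x != 0]) &
      closure [set x | phi x != 0] `<=` O].

Definition locally_lipschitz O v : Prop :=
  forall x, O x -> exists2 U, nbhs x U & [lipschitz v y | y in U].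

End several_variables.

(* The n-dimensional Lebesgue measure, carried by n.-tuple R because row
   vectors have no measurable structure in the library. *)
Section lebesgue_measure_on_tuples.
Local Open Scope ereal_scope.
Variable R : realType.
Local Notation tuples n := (n.-tuple (measurableTypeR R)).

Definition cons_pair n (p : measurableTypeR R * tuples n) : tuples n.+1 :=
  [the _.-tuple _ of p.1 :: p.2].

Lemma measurable_cons_pair n : measurable_fun setT (@cons_pair n).
Proof. exact: (measurable_cons measurable_fst measurable_snd). Qed.

Definition lebesgue_cons n (mu : {measure set (tuples n) -> \bar R}) :
    set (tuples n.+1) -> \bar R :=
  pushforward (@lebesgue_measure R \x^ mu) (@cons_pair n).

HB.instance Definition _ n mu := Measure.copy (@lebesgue_cons n mu)
  (measure_function_pushforward__canonical__measure_function_Measure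
    (@lebesgue_measure R \x^ mu) (@measurable_cons_pair n)).

Fixpoint lebesgue_tuple (n : nat) : {measure set (tuples n) -> \bar R} :=
  match n with
  | 0 => dirac [tuple]
  | n'.+1 => lebesgue_cons (lebesgue_tuple n')
  end.

(* These values on boxes determine the measure. *)
Lemma lebesgue_tuple_box n (A : 'I_n -> set (measurableTypeR R)) :
  (forall i, measurable (A i)) ->
  lebesgue_tuple n [set p | forall i, A i (tnth p i)] =
  \prod_(i < n) lebesgue_measure (A i).
Proof.
elim: n A => [|n IHn] A mA.
  by rewrite big_ord0 /= diracE mem_set//= => -[].
rewrite big_ord_recl /= -IHn; last by move=> i; exact: mA.
rewrite /lebesgue_cons /pushforward.
set B := [set p | _]; set C := [set p | _].
have -> : @cons_pair n @^-1` B = A ord0 `*` C.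
  apply/seteqP; split=> -[a p] /=.
    move=> AB; split; first exact: (AB ord0).
    by move=> i; have := AB (lift ord0 i); rewrite tnthS.
  move=> [Aa Ap] i; case: (unliftP ord0 i) => [j|] -> //.
  by rewrite tnthS; exact: Ap.
rewrite product_measure2E//.
have -> : C = \bigcap_(i in [set: 'I_n])
    (fun p : tuples n => tnth p i) @^-1` A (lift ord0 i).
  by apply/seteqP; split=> p Cp i; [move=> _; exact: Cp | exact: Cp].
apply: fin_bigcap_measurable => [|i _]; first exact: finite_finset.
by rewrite -[X in measurable X]setTI; exact: measurable_tnth.
Qed.

End lebesgue_measure_on_tuples.

Section weak_formulation.
Variables (R : realType) (n : nat).

Definition row_of_tuple (p : n.-tuple (measurableTypeR R)) : 'rV[R]_n :=
  \row_i tnth p i.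

Definition integral_on (O : set 'rV[R]_n) (g : 'rV[R]_n -> R) : \bar R :=
  (\int[lebesgue_tuple R n]_(p in row_of_tuple @^-1` O)
     (g (row_of_tuple p))%:E)%E.

(* The gradient of a locally Lipschitz v is taken pointwise: it exists almost
   everywhere (Rademacher) and coincides with the weak gradient. Where v has no
   partial derivative, [partial] returns a default value on a null set, which
   does not change the integral. *)
Definition weak_supersolution (f : R -> R) (O : set 'rV[R]_n)
    (v : 'rV[R]_n -> R) : Prop :=
  locally_lipschitz O v /\
  forall phi, test_function O phi -> (forall x, 0 <= phi x) ->
    (integral_on O (fun x => f (v x) * phi x)%R <=
     integral_on O (fun x => \sum_(i < n) partial i v x * partial i phi x)%R)%E.

End weak_formulation.

Section simons_cone.
Variables (R : realType) (m : nat).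

Definition s_coord (x : 'rV[R]_(m + m)) : R :=
  Num.sqrt (\sum_(i < m) x ord0 (lshift m i) ^+ 2).

Definition t_coord (x : 'rV[R]_(m + m)) : R :=
  Num.sqrt (\sum_(i < m) x ord0 (rshift m i) ^+ 2).

Definition simons_cone : set 'rV[R]_(m + m) :=
  [set x | s_coord x = t_coord x].

End simons_cone.
Arguments simons_cone {R m}.

(* Main.v *)
(** The bound on [u] rests on a sharp gradient bound of Modica type, proved
    without elliptic regularity by comparing two points. For [c > 0] let
    [h' = 1 / sqrt (2 (G + c))] and [w = h (u)]; then [w] is bounded and
    [Delta w = b (w) (1 - |grad w|^2)] with [b] bounded. If [w] were not
    1-Lipschitz, [w x - w y - psi |x - y| - eps |x|^2], with [psi] increasing,
    strictly concave and [psi' > 1], would have a positive maximum, where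
    reflecting the directions at [y] in the line through [x] and [y] gives
    [Delta w x - Delta w y <= 4 psi'' + o(1)], which the equation excludes.
    Evaluating at a point [y] of the cone nearest to [x] and letting [c] tend to
    0 turns [h] into the inverse of [u0], because [u0'^2 = 2 G u0].

    For the supersolution, replace [s] and [t] by [sqrt (s^2 + e)] and
    [sqrt (t^2 + e)]: where [s > t], the smooth function obtained satisfies the
    inequality pointwise up to a factor that tends to 1 off [{s = 0}] and
    [{t = 0}]. Integrate by parts against the test function and let [e] tend
    to 0 by dominated convergence. *)

Require Import Defs.
From HB Require Import structures.
From mathcomp Require Import all_boot all_order all_algebra.
From mathcomp Require Import all_classical all_reals all_analysis.
From mathcomp Require Import measurable_realfun ring lra.

Set Implicit Arguments.
Unset Strict Implicit.
Unset Printing Implicit Defensive.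

Import Order.TTheory GRing.Theory Num.Theory.
Import numFieldNormedType.Exports.
Local Open Scope ring_scope.
Local Open Scope classical_set_scope.

(** * One variable *)

(** The classical route to such a gradient bound differentiates the equation satisfied by
    [|grad u|^2 - 2 G (u)], which costs a third derivative of [u] and a compactness argument for
    translates. Comparing values at two points uses only second derivatives along lines, at a
    maximum that the penalty makes attained on the unbounded space. The shift [c > 0] is forced
    because [G] vanishes at [M] and [- M], possibly also beyond, and nothing yet confines [u] to
    [(- M, M)]. The bounds on [w] and [b] deteriorate as [c] tends to 0, but the Lipschitz constant
    1 does not depend on them. For the supersolution the obstacle is the set [t = 0], which meets
    [s > t]: there [s - t] has a kink, and the gradient takes a default value. Adding the same [e]
    under both roots preserves the order of [s] and [t], so the difference of the two Laplacians
    keeps its sign up to the kink. *)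

Lemma is_deriveW (R : realType) (f : R -> R) (x : R) :
  derivable f x 1 -> is_derive x 1 f (f^`()%classic x).
Proof. by move=> df; rewrite derive1E; exact: derivableP. Qed.

Lemma C1_fun_continuous (R : realType) (f : R -> R) : C1_fun f -> continuous f.
Proof.
by move=> [df _] x; apply/differentiable_continuous/derivable1_diffP.
Qed.

Lemma continuous_integrable_itv (R : realType) (f : R -> R) (a b : R) :
  continuous f -> (@lebesgue_measure R).-integrable `[a, b] (EFin \o f).
Proof.
move=> cf; apply: continuous_compact_integrable.
  exact: segment_compact.
exact: continuous_subspaceT.
Qed.

(** A base point [a] to the left of everything absorbs both cases of the sign convention and leaves
    an integral with a moving upper end, the form covered by the fundamental theorem. *)
Lemma oriented_integral_split (R : realType) (f : R -> R) (a b y : R) :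
  continuous f -> a <= b -> a <= y ->
  oriented_integral f y b = (\int[lebesgue_measure]_(x in `[a, b]) f x) -
    (\int[lebesgue_measure]_(x in `[a, y]) f x).
Proof.
move=> cf ab ay; have If p q := @continuous_integrable_itv R f p q cf.
have key p q : a <= p -> p <= q ->
    \int[lebesgue_measure]_(x in `[a, q]) f x -
    \int[lebesgue_measure]_(x in `[a, p]) f x =
    \int[lebesgue_measure]_(x in `[p, q]) f x.
  move=> ap pq; rewrite Rintegral_itvB//.
  apply: Rintegral_itv_obnd_cbnd.
  by apply: integrableS (If p q) => //; exact: subset_itv_oc_cc.
rewrite /oriented_integral; case: ifPn => [yb|]; first by rewrite key.
by rewrite -ltNge => /ltW by_; rewrite -(key b y)// opprB.
Qed.

Lemma is_derive_oriented_integral (R : realType) (f : R -> R) (b x : R) :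
  continuous f -> is_derive x 1 (fun y => oriented_integral f y b) (- f x).
Proof.
(* The margin 1 keeps [a] strictly below [x], hence below every [y] near [x]. *)
move=> cf; pose a := Num.min x b - 1.
have ax : a < x by rewrite /a ltrBlDr;
  apply: le_lt_trans (ltr_pwDr ltr01 (lexx _)); rewrite ge_min lexx.
have ab : a <= b by rewrite /a lerBlDr;
  apply: le_trans (ltW (ltr_pwDr ltr01 (lexx _))); rewrite ge_min lexx orbT.
pose F y := \int[lebesgue_measure]_(t in `[a, y]) f t.
apply: (@near_eq_is_derive _ _ _ (fun y =>
  (\int[lebesgue_measure]_(t in `[a, b]) f t) - F y)).
  near=> y; rewrite (oriented_integral_split cf ab)//.
  by apply: ltW; near: y; exact: lt_nbhsr.
have [dF F'] : derivable F x 1 /\ F^`() x = f x.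
  apply: (@continuous_FTC1_closed _ f a x (x + 1)) => //;
    first by rewrite ltrDl.
    exact: continuous_integrable_itv.
  exact: cf.
have /is_deriveW := dF; rewrite F' => ?.
rewrite -[- f x]sub0r; exact: is_deriveB.
Unshelve. all: by end_near. Qed.

Lemma is_derive_MVT (R : realType) (g g' : R -> R) (a b : R) :
  (forall x : R, is_derive x 1 g (g' x)) -> a <= b ->
  exists2 c, a <= c <= b & g b - g a = g' c * (b - a).
Proof.
move=> dg ab; have [|c cab E] := @MVT_segment R g g' a b ab (fun x _ => dg x).
  by apply: continuous_subspaceT => x;
    apply/differentiable_continuous/derivable1_diffP; have [] := dg x.
by exists c => //; rewrite -in_itv/=.
Qed.

(** Since [g1] is differentiable at 0 only, a second-order expansion is replaced by the mean value
    theorem: if [a > 0], the difference quotients make [g1] positive just to the right of 0, so [g]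
    would exceed [g 0] there. *)
Lemma second_derivative_at_max (R : realType) (g g1 : R -> R) (a d : R) :
  (forall s : R, is_derive s 1 g (g1 s)) -> is_derive (0 : R) 1 g1 a ->
  0 < d -> (forall s, `|s| < d -> g s <= g 0) -> g1 0 = 0 /\ a <= 0.
Proof.
move=> dg dg1 d0 gmax.
have g10 : g1 0 = 0.
  have [_ E] : is_derive (0 : R) 1 g 0.
    apply: (@derive1_at_max R g (- d) d 0).
    - by rewrite (@le_trans _ _ 0) ?oppr_le0 ?ltW.
    - by move=> t _; have [] := dg t.
    - by rewrite in_itv/= d0 oppr_lt0 d0.
    - by move=> t; rewrite in_itv/= -ltr_norml => /gmax.
  by have [_ <-] := dg 0.
split=> //; rewrite leNgt; apply/negP => a0.
have [cl da] := dg1.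
have la : (fun h => h^-1 *: (g1 (h *: 1 + 0) - g1 0)) @ 0^' --> a.
  rewrite -da. exact: cl.
move/cvgrPdist_lt : la => /(_ _ a0)/nbhs_ballP[e /= e0 He].
pose h := Num.min d e / 2.
have m0 : 0 < Num.min d e by rewrite lt_min d0.
have h0 : 0 < h by rewrite divr_gt0.
have hm : h < Num.min d e by rewrite /h ltr_pdivrMr// mulr2n mulrDr mulr1 ltrDl.
have [c /andP[c0 ch] E] : exists2 c, 0 < c < h & g h - g 0 = g1 c * (h - 0).
  have [|c] := @MVT R g g1 0 h h0 (fun x _ => dg x).
    by apply: continuous_subspaceT => x;
      apply/differentiable_continuous/derivable1_diffP; have [] := dg x.
  by rewrite in_itv/=; exists c.
have : g h <= g 0.
  by apply: gmax; rewrite gtr0_norm//; apply: lt_le_trans hm _;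
    rewrite ge_min lexx.
have : `|a - c^-1 *: (g1 (c *: 1 + 0) - g1 0)| < a.
  apply: (He c); last by rewrite gt_eqF.
  rewrite /ball/= sub0r normrN gtr0_norm//; apply: lt_trans ch _.
  by apply: lt_le_trans hm _; rewrite ge_min lexx orbT.
rewrite g10 subr0 addr0 [c *: 1]mulr1 -subr_le0 E subr0 => H1 H2.
have c1 : g1 c <= 0 by move: H2; rewrite pmulr_lle0.
have : c^-1 *: g1 c <= 0 by rewrite /GRing.scale/= pmulr_rle0// invr_gt0.
move: H1 => /ltr_normlP[_ H1] H3.
lra.
Qed.

(** * Directional derivatives *)

Lemma is_derive_sumE (R : realType) (V : normedModType R) n
    (h : 'I_n -> V -> R) (x v : V) (dh : 'I_n -> R) :
  (forall i, is_derive x v (h i) (dh i)) ->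
  is_derive x v (fun y => \sum_(i < n) h i y) (\sum_(i < n) dh i).
Proof.
move=> dh_; have -> : (fun y => \sum_(i < n) h i y) = \sum_(i < n) h i.
  by apply/funext => y; rewrite fct_sumE.
exact: is_derive_sum.
Qed.

Lemma is_derive_line (R : realType) (V : normedModType R) (f : V -> R)
    (x v : V) (s a : R) :
  is_derive (x + s *: v) v f a -> is_derive s 1 (fun t : R => f (x + t *: v)) a.
Proof.
move=> [df da].
have E : (fun h : R => h^-1 *: (((fun t : R =>
  f (x + t *: v)) \o shift s) (h *: 1) -
    f (x + s *: v))) = (fun h => h^-1 *: ((f \o shift (x + s *: v)) (h *: v) -
      f (x + s *: v))).
  apply/funext => h /=; rewrite [h *: 1]mulr1 scalerDl.
  by rewrite addrCA.
split; first by rewrite /derivable E.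
by rewrite -da /derive E.
Qed.

(** Together with [is_derive_line] this transports one-variable rules, in particular the chain rule,
    to directional derivatives. *)
Lemma is_derive_of_line (R : realType) (V : normedModType R) (f : V -> R)
    (x v : V) (a : R) :
  is_derive (0 : R) 1 (fun t : R => f (x + t *: v)) a -> is_derive x v f a.
Proof.
move=> [df da].
have E : (fun h : R => h^-1 *: (((fun t : R =>
  f (x + t *: v)) \o shift 0) (h *: 1) -
    f (x + 0 *: v))) = (fun h => h^-1 *: ((f \o shift x) (h *: v) - f x)).
  apply/funext => h /=; rewrite [h *: 1]mulr1 addr0 scale0r addr0.
  by rewrite [h *: v + x]addrC.
split; first by rewrite /derivable -E.
by rewrite -da /derive -E.
Qed.

(* Uniformity in the base point makes these derivatives additive in the
   direction. *)
Definition strict_derive (R : realType) (V : normedModType R) (u : V -> R)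
    (x v : V) (l : R) : Prop :=
  forall e, 0 < e -> exists2 d, 0 < d & forall y h, `|y - x| < d -> `|h| < d ->
    `|u (y + h *: v) - u y - h * l| <= e * `|h|.

Section strict_derive.
Variables (R : realType) (V : normedModType R).
Implicit Types (u : V -> R) (x v w : V) (l k c : R).

Lemma strict_derive0 u x : strict_derive u x 0 0.
Proof.
move=> e e0; exists 1 => // y h _ _.
by rewrite scaler0 addr0 subrr mulr0 subr0 normr0 mulr_ge0// ltW.
Qed.

Lemma strict_deriveZ u x v l c :
  strict_derive u x v l -> strict_derive u x (c *: v) (c * l).
Proof.
move=> ul e e0; have c0 : 0 < 1 + `|c| by rewrite ltr_pwDl.
have [d d0 H] := ul (e / (1 + `|c|)) (divr_gt0 e0 c0).
exists (d / (1 + `|c|)); first exact: divr_gt0.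
move=> y h yx hd; rewrite scalerA mulrA.
apply: le_trans (H _ _ _ _) _.
- by apply: lt_le_trans yx _; rewrite ler_pdivrMr// ler_peMr ?lerDl// ltW.
- rewrite normrM; apply: le_lt_trans (_ : `|h| * (1 + `|c|) < d).
    by rewrite ler_wpM2l// lerDr.
  by rewrite -ltr_pdivlMr.
rewrite normrM mulrAC ler_pdivrMr// mulrA ler_wpM2l ?mulr_ge0 ?lerDr//.
exact: ltW.
Qed.

Lemma strict_deriveD u x v w l k : strict_derive u x v l ->
  strict_derive u x w k -> strict_derive u x (v + w) (l + k).
Proof.
move=> ul uk e e0; have e2 : 0 < e / 2 by rewrite divr_gt0.
have [d d0 H] := ul _ e2; have [d' d'0 H'] := uk _ e2.
have v0 : 0 < 1 + `|v| by rewrite ltr_pwDl.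
pose m := Num.min d d'; have m0 : 0 < m by rewrite lt_min d0.
have md : m <= d by rewrite ge_min lexx.
have md' : m <= d' by rewrite ge_min lexx orbT.
(* The increment is taken along [v] and then along [w]; this radius keeps the intermediate base
   point [y + h v] close enough to [x]. *)
pose r := m / (2 * (1 + `|v|)).
have rm2 : r <= m / 2.
  rewrite /r invfM mulrA ler_pdivrMr// ler_peMr ?lerDl//.
  by rewrite divr_ge0 // ltW.
have r0 : 0 < r by rewrite divr_gt0 ?mulr_gt0.
exists r => // y h yx hr.
have hm : `|h| < m by apply: lt_le_trans hr (le_trans rm2 _);
  rewrite ler_pdivrMr// ler_peMr ?ler1n// ltW.
have y1 : `|y - x| < d.
  by apply: lt_le_trans yx (le_trans rm2 (le_trans _ md));
    rewrite ler_pdivrMr// ler_peMr ?ler1n// ltW.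
have y2 : `|y + h *: v - x| < d'.
  rewrite addrAC; apply: le_lt_trans (ler_normD _ _) _.
  apply: lt_le_trans md'; rewrite (splitr m); apply: ltr_leD;
    first exact: lt_le_trans rm2.
  rewrite normrZ; apply: le_trans (_ : `|h| * (1 + `|v|) <= _);
    first by rewrite ler_wpM2l// lerDr.
  by move/ltW: hr; rewrite /r invfM mulrA ler_pdivlMr.
have := H y h y1 (lt_le_trans hm md).
have := H' (y + h *: v) h y2 (lt_le_trans hm md').
rewrite -[y + _ + _]addrA -scalerDr => A B.
have -> : u (y + h *: (v + w)) - u y - h * (l + k) =
  (u (y + h *: (v + w)) - u (y + h *: v) - h * k) + (u (y + h *: v) - u y - h
    * l) by ring.
apply: le_trans (ler_normD _ _) _.
by rewrite [e]splitr mulrDl; exact: lerD.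
Qed.

Lemma strict_derive_is_derive u x v l :
  strict_derive u x v l -> is_derive x v u l.
Proof.
move=> ul.
suff cl : (fun h => h^-1 *: ((u \o shift x) (h *: v) - u x)) @ 0^' --> l.
  split; first by apply/cvg_ex; exists l.
  by apply/cvg_lim.
apply/cvgrPdist_le => e e0; have [d d0 H] := ul _ e0.
apply/nbhs_ballP; exists d => //= h; rewrite /ball/= sub0r normrN => hd h0.
have := H x h; rewrite subrr normr0 => /(_ d0 hd).
have h0' : 0 < `|h| by rewrite normr_gt0.
rewrite -ler_pdivrMr// -normfV -normrM.
rewrite distrC [h *: v + x]addrC; congr (`|_| <= _).
rewrite mulrBl [h * l]mulrC mulfK; last by rewrite -normr_gt0.
by rewrite mulrC.
Qed.

(** By the mean value theorem on the segment from [y] to [y + h v], the increment is [h] times the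
    derivative at an intermediate point, which continuity compares with the derivative at [x]. *)
Lemma continuous_strict_derive u v : (forall x, derivable u x v) ->
  continuous ('D_v u) -> forall x, strict_derive u x v ('D_v u x).
Proof.
move=> du cdu x e e0; have v0 : 0 < 1 + `|v| by rewrite ltr_pwDl.
have /cvgrPdist_le/(_ _ e0)/nbhs_ballP[d /= d0 H] := cdu x.
exists (d / (2 * (1 + `|v|))); first by rewrite divr_gt0// mulr_gt0.
have key y h : `|y - x| < d / (2 * (1 + `|v|)) -> `|h| < d / (2 * (1 + `|v|)) ->
    `|'D_v u x - 'D_v u (y + h *: v)| <= e.
  move=> yx hd; apply: H; rewrite -ball_normE /ball_ /= opprD addrA;
    apply: le_lt_trans (ler_normB _ _) _.
  rewrite (splitr d); apply: ltr_leD.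
    rewrite distrC; apply: lt_le_trans yx _.
    rewrite invfM mulrA ler_pdivrMr// ler_peMr ?lerDl//.
    by rewrite divr_ge0 // ltW.
  rewrite normrZ; apply: le_trans (_ : `|h| * (1 + `|v|) <= _);
    first by rewrite ler_wpM2l// lerDr.
  by move/ltW: hd; rewrite invfM mulrA ler_pdivlMr.
have dline y (s : R) : is_derive s 1 (fun t : R =>
  u (y + t *: v)) ('D_v u (y + s *: v)).
  by apply: is_derive_line; exact: derivableP.
move=> y h yx hd.
have [c hc ->] : exists2 c, `|c| <= `|h| & u (y + h *: v) - u y = 'D_v u (y +
  c *: v) * h.
  have [h0|h0] := leP 0 h.
    have [c /andP[c0 ch]] := is_derive_MVT (dline y) h0.
    rewrite scale0r addr0 subr0; exists c => //.
    by rewrite !ger0_norm.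
  have [c /andP[c0 ch]] := is_derive_MVT (dline y) (ltW h0).
  rewrite scale0r addr0 sub0r mulrN => /eqP; rewrite -eqr_oppLR opprB => /eqP E.
  exists c => //; rewrite !ler0_norm ?lerN2// ltW//.
rewrite mulrC -mulrBr normrM mulrC ler_wpM2r// distrC.
by apply: key => //; exact: le_lt_trans hc hd.
Qed.

End strict_derive.

(** * Functions with continuous partial derivatives *)

Section class_C.
Variables (R : realType) (n : nat).
Implicit Types (u : 'rV[R]_n -> R) (x v : 'rV[R]_n).

(** Each partial derivative is strict because it is continuous, and strict derivatives add up along
    the decomposition of [v] in the standard basis. *)
Lemma class_C_is_derive u : class_C 1 u -> forall x v,
  is_derive x v u (\sum_(i < n) v ord0 i * partial i u x).
Proof.
move=> [_ Cu] x v; apply: strict_derive_is_derive.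
rewrite [v in strict_derive _ _ v _]row_sum_delta.
elim/big_ind2 : _ => [|? ? ? ? |i _];
  [exact: strict_derive0|exact: strict_deriveD|].
by apply: strict_deriveZ; apply: continuous_strict_derive; have [? []] := Cu i.
Qed.

Lemma class_C_partial k u i : class_C k.+1 u -> class_C k (partial i u).
Proof. by move=> [_ /(_ i)[]]. Qed.

Lemma class_CS k u : class_C k.+1 u -> class_C k u.
Proof.
elim: k u => [u []//|k IHk u [cu Cu]]; split=> // i.
by have [? /IHk] := Cu i.
Qed.

Definition gradient_dot u x v : R := \sum_(i < n) v ord0 i * partial i u x.

Definition hessian u x v : R := \sum_(i < n) v ord0 i * gradient_dot (partial
  i u) x v.

Lemma class_C_line1 u x v (s : R) : class_C 1 u ->
  is_derive s 1 (fun t : R => u (x + t *: v)) (gradient_dot u (x + s *: v) v).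
Proof. by move=> Cu; apply: is_derive_line; exact: class_C_is_derive. Qed.

Lemma class_C_line2 u x v (s : R) : class_C 2 u ->
  is_derive s 1 (fun t : R => gradient_dot u (x + t *: v) v) (hessian u (x + s
    *: v) v).
Proof.
move=> Cu; apply: is_derive_sumE => i.
have ? := class_C_line1 x v s (class_C_partial i Cu).
exact: (@is_deriveZ _ _ _ (fun t : R => partial i u (x + t *: v))).
Qed.

End class_C.

(** * Euclidean structure *)

Section pointwise_derivatives.
Variables (R : realType) (V : normedModType R).
Implicit Types (f g : V -> R) (x v : V) (a b c : R).

Lemma is_derive_cstE c x v : is_derive x v (fun _ => c) 0.
Proof. exact: is_derive_cst. Qed.

Lemma is_derive_addE f g x v a b : is_derive x v f a -> is_derive x v g b ->
  is_derive x v (fun y => f y + g y) (a + b).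
Proof. by move=> ? ?; exact: is_deriveD. Qed.

Lemma is_derive_subE f g x v a b : is_derive x v f a -> is_derive x v g b ->
  is_derive x v (fun y => f y - g y) (a - b).
Proof. by move=> ? ?; exact: is_deriveB. Qed.

Lemma is_derive_oppE f x v a : is_derive x v f a ->
  is_derive x v (fun y => - f y) (- a).
Proof. by move=> ?; exact: is_deriveN. Qed.

Lemma is_derive_mulE f g x v a b : is_derive x v f a -> is_derive x v g b ->
  is_derive x v (fun y => f y * g y) (f x * b + a * g x).
Proof.
by move=> df dg; rewrite [a * _]mulrC; exact: (@is_deriveM _ _ f g).
Qed.

Lemma is_derive_scaleE f x v a c : is_derive x v f a ->
  is_derive x v (fun y => c * f y) (c * a).
Proof. by move=> df; exact: (@is_deriveZ _ _ _ f). Qed.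

Lemma is_derive_compE (h : R -> R) f x v a b : is_derive (f x) 1 h b ->
  is_derive x v f a -> is_derive x v (fun y => h (f y)) (b * a).
Proof.
move=> dh df; apply: is_derive_of_line.
apply: (@is_derive1_comp _ h (fun t : R => f (x + t *: v))).
  by rewrite scale0r addr0.
by apply: is_derive_line; rewrite scale0r addr0.
Qed.

Lemma is_derive_sqrE f x v a : is_derive x v f a ->
  is_derive x v (fun y => f y ^+ 2) (2 * f x * a).
Proof.
move=> df; have := is_derive_mulE df df.
have -> : (fun y => f y * f y) = (fun y => f y ^+ 2) by apply/funext => y;
  rewrite expr2.
by move=> H; apply: is_derive_eq H _; ring.
Qed.

End pointwise_derivatives.

Lemma is_derive_idE (R : realType) (x : R) : is_derive x 1 (fun y : R => y) 1.
Proof. exact: is_derive_id. Qed.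

Lemma is_derive_eqE (R : realType) (V : normedModType R) (f : V -> R) (x v : V)
  (a b : R) : a = b -> is_derive x v f a -> is_derive x v f b.
Proof. by move=> ->. Qed.

Section pointwise_continuity.
Variables (R : realType) (T : topologicalType).
Implicit Types f g : T -> R.

Lemma continuous_addE f g : continuous f -> continuous g ->
  continuous (fun t => f t + g t).
Proof. by move=> cf cg t; apply: cvgD; [exact: cf|exact: cg]. Qed.

Lemma continuous_oppE f : continuous f -> continuous (fun t => - f t).
Proof. by move=> cf t; apply: cvgN; exact: cf. Qed.

Lemma continuous_mulE f g : continuous f -> continuous g ->
  continuous (fun t => f t * g t).
Proof. by move=> cf cg t; apply: cvgM; [exact: cf|exact: cg]. Qed.

Lemma continuous_sqrE f : continuous f -> continuous (fun t => f t ^+ 2).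
Proof.
move=> cf; rewrite (_ : (fun t => _) = (fun t => f t * f t)); last first.
  by apply/funext => t; rewrite expr2.
exact: continuous_mulE.
Qed.

Lemma continuous_invE f : (forall t, f t != 0) -> continuous f ->
  continuous (fun t => (f t)^-1).
Proof. by move=> f0 cf t; apply: cvgV; [exact: f0|exact: cf]. Qed.

Lemma continuous_cstE (c : R) : continuous (fun _ : T => c).
Proof. by move=> t; exact: cvg_cst. Qed.

Lemma continuous_compE (h : R -> R) f : continuous h -> continuous f ->
  continuous (fun t => h (f t)).
Proof.
by move=> ch cf t; apply: (@continuous_comp _ _ _ f h); [exact: cf|exact: ch].
Qed.

Lemma continuous_sumE k (h : 'I_k -> T -> R) :
  (forall i, continuous (h i)) -> continuous (fun t => \sum_(i < k) h i t).
Proof.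
move=> ch t; have -> : (fun t => \sum_(i < k) h i t) = \sum_(i < k) h i.
  by apply/funext => y; rewrite fct_sumE.
elim/big_ind : _ => [|f g cf cg|i _];
  [exact: cst_continuous|exact: continuousD|exact: ch].
Qed.

End pointwise_continuity.

(** * The Euclidean scalar product and norm *)

Section euclid.
Variables (R : realType) (n : nat).
Implicit Types (x y v w : 'rV[R]_n).

Definition dotr x y : R := \sum_(i < n) x ord0 i * y ord0 i.

Lemma dotrC x y : dotr x y = dotr y x.
Proof. by apply: eq_bigr => i _; rewrite mulrC. Qed.

Lemma dotrDl x y v : dotr (x + y) v = dotr x v + dotr y v.
Proof. by rewrite -big_split; apply: eq_bigr => i _; rewrite mxE mulrDl. Qed.

Lemma dotrZl c x y : dotr (c *: x) y = c * dotr x y.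
Proof. by rewrite mulr_sumr; apply: eq_bigr => i _; rewrite mxE mulrA. Qed.

Lemma dotrNl x y : dotr (- x) y = - dotr x y.
Proof. by rewrite -scaleN1r dotrZl mulN1r. Qed.

Lemma dotrDr x y v : dotr v (x + y) = dotr v x + dotr v y.
Proof. by rewrite dotrC dotrDl !(dotrC v). Qed.

Lemma dotrZr c x y : dotr x (c *: y) = c * dotr x y.
Proof. by rewrite dotrC dotrZl dotrC. Qed.

Lemma sum_delta_mx (c : 'I_n -> R) i :
  \sum_(j < n) (delta_mx ord0 i : 'rV[R]_n) ord0 j * c j = c i.
Proof.
rewrite (bigD1 i)//= big1 ?addr0 ?mxE ?eqxx ?mul1r// => j ji.
by rewrite mxE (negPf ji) andbF mul0r.
Qed.

Lemma dotr_delta x i : dotr x (delta_mx ord0 i) = x ord0 i.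
Proof. by rewrite dotrC; exact: sum_delta_mx. Qed.

Lemma dotr_ge0 x : 0 <= dotr x x.
Proof. by apply: sumr_ge0 => i _; rewrite -expr2 sqr_ge0. Qed.

Lemma euclid_normE x : euclid_norm x = Num.sqrt (dotr x x).
Proof. by congr Num.sqrt; apply: eq_bigr => i _; rewrite expr2. Qed.

Lemma euclid_norm_ge0 x : 0 <= euclid_norm x.
Proof. exact: sqrtr_ge0. Qed.

Lemma sqr_euclid_norm x : euclid_norm x ^+ 2 = dotr x x.
Proof. by rewrite euclid_normE sqr_sqrtr// dotr_ge0. Qed.

Lemma ler_euclid_norm x (a : R) : 0 <= a -> dotr x x <= a ^+ 2 ->
  euclid_norm x <= a.
Proof.
by move=> a0 xa; rewrite -(@ler_pXn2r _ 2)// ?nnegrE ?euclid_norm_ge0//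
  sqr_euclid_norm.
Qed.

Lemma euclid_norm0_eq0 x : euclid_norm x = 0 -> x = 0.
Proof.
move=> x0; apply/rowP => i; rewrite mxE; apply/eqP.
have /eqP := sqr_euclid_norm x; rewrite x0 expr0n/= eq_sym psumr_eq0.
  by move=> /allP/(_ i)/=; rewrite mem_index_enum mulf_eq0 orbb; exact.
by move=> j _; rewrite -expr2 sqr_ge0.
Qed.

Lemma Cauchy_Schwarz x y : `|dotr x y| <= euclid_norm x * euclid_norm y.
Proof.
set a := euclid_norm x; set b := euclid_norm y.
have a0 : 0 <= a := euclid_norm_ge0 x; have b0 : 0 <= b := euclid_norm_ge0 y.
have aa : a ^+ 2 = dotr x x := sqr_euclid_norm x.
have bb : b ^+ 2 = dotr y y := sqr_euclid_norm y.
have key (c : R) : 0 <= dotr x x + 2 * c * dotr x y + c ^+ 2 * dotr y y.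
  have := dotr_ge0 (x + c *: y).
  rewrite !dotrDl !dotrDr !dotrZl !dotrZr (dotrC y x); congr (_ <= _); ring.
have [/euclid_norm0_eq0 ->|bn0] := eqVneq b 0.
  rewrite (_ : dotr x 0 = 0) ?normr0 ?mulr_ge0//.
  by apply: big1 => i _; rewrite mxE mulr0.
have b2 : 0 < b ^+ 2 by rewrite exprn_gt0// lt_neqAle eq_sym bn0.
(* This value of [c] minimises the quadratic polynomial in [key]. *)
have := key (- dotr x y / b ^+ 2); rewrite -bb -aa.
have -> : a ^+ 2 + 2 * (- dotr x y / b ^+ 2) * dotr x y + (- dotr x y / b ^+
  2) ^+ 2 * b ^+ 2
  = a ^+ 2 - dotr x y ^+ 2 / b ^+ 2 by field.
rewrite subr_ge0 ler_pdivrMr// -exprMn => H.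
by rewrite -(@ler_pXn2r _ 2)// ?nnegrE ?mulr_ge0// real_normK ?num_real.
Qed.

Lemma euclid_normD x y : euclid_norm (x + y) <= euclid_norm x + euclid_norm y.
Proof.
apply: ler_euclid_norm; first by rewrite addr_ge0 ?euclid_norm_ge0.
rewrite sqrrD !sqr_euclid_norm dotrDl !dotrDr (dotrC y x).
have := Cauchy_Schwarz x y; have := ler_norm (dotr x y); lra.
Qed.

Lemma euclid_normZ c x : euclid_norm (c *: x) = `|c| * euclid_norm x.
Proof.
by rewrite !euclid_normE dotrZl dotrZr mulrA -expr2 sqrtrM ?sqr_ge0// sqrtr_sqr.
Qed.

Lemma euclid_normN x : euclid_norm (- x) = euclid_norm x.
Proof. by rewrite -scaleN1r euclid_normZ normrN1 mul1r. Qed.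

Lemma coord_le_euclid_norm x i : `|x ord0 i| <= euclid_norm x.
Proof.
rewrite -sqrtr_sqr; apply: ler_wsqrtr; rewrite (bigD1 i)//= lerDl.
by apply: sumr_ge0 => j _; rewrite sqr_ge0.
Qed.

Lemma norm_le_euclid_norm x : `|x| <= euclid_norm x.
Proof.
rewrite /Num.norm/= mx_normrE; apply/bigmax_leP; split;
  first exact: euclid_norm_ge0.
by move=> [i j] _ /=; rewrite (ord1 i); exact: coord_le_euclid_norm.
Qed.

Lemma coord_le_norm x i : `|x ord0 i| <= `|x|.
Proof.
by rewrite [leRHS]/Num.norm/= mx_normrE; apply/bigmax_geP; right;
  exists (ord0, i).
Qed.

Lemma euclid_norm_le_norm x : euclid_norm x <= n%:R * `|x|.
Proof.
apply: ler_euclid_norm; first by rewrite mulr_ge0.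
have : dotr x x <= \sum_(i < n) `|x| ^+ 2.
  apply: ler_sum => i _; rewrite -expr2 -real_normK ?num_real//.
  by rewrite ler_pXn2r ?nnegrE// coord_le_norm.
move=> /le_trans; apply; rewrite sumr_const card_ord -[_ *+ n]mulr_natl exprMn
  ler_wpM2r ?sqr_ge0//.
by rewrite -natrX ler_nat; case: (n) => // k; rewrite expnS expn1 leq_pmulr.
Qed.

Lemma continuous_coord i : continuous (fun x => x ord0 i).
Proof. exact: coord_continuous. Qed.

Lemma continuous_dotr : continuous (fun x => dotr x x).
Proof.
apply: continuous_sumE => i x.
by apply: continuousM; exact: continuous_coord.
Qed.

Lemma continuous_euclid_norm : continuous (@euclid_norm R n).
Proof.
move=> x; rewrite (_ : @euclid_norm R n = Num.sqrt \o (fun x => dotr x x)).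
  by apply: continuous_comp; [exact: continuous_dotr|exact: sqrt_continuous].
by apply/funext => y; rewrite euclid_normE.
Qed.

End euclid.

(** * The two-point maximum principle *)

(** The closing arithmetic of [two_point_inequality] with its products abstracted: [a] and [b] stand
    for [f p] at the two points, [S] and [q] for the squared gradients of [w = h (u)] there, and [c]
    for [psi'']. *)
Lemma two_point_arith (R : realDomainType) (B a S b q c d T Y Y' : R) :
  a * S - a - (b * q - b) - 4 * c - d <= 0 ->
  - (B * (T + Y + Y')) <= a * (S - 1) -> b * (q - 1) <= B * T ->
  - 4 * c <= d + B * (2 * T + Y + Y').
Proof. by move=> *; lra. Qed.

Section two_point.
Variables (R : realType) (n : nat) (u : 'rV[R]_n -> R) (f h p : R -> R).
Variable B : R.
Hypotheses (Cu : class_C 2 u) (solu : forall x, - laplacian u x = f (u x)).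
(* [p = 1 / sqrt (2 (G + c))] with [G' = - f] satisfies [p' = f p^3]. *)
Hypotheses (dh : forall y : R, is_derive y 1 h (p y))
  (dp : forall y : R, is_derive y 1 p (f y * p y ^+ 3)).
Hypothesis fpB : forall x, `|f (u x) * p (u x)| <= B.
Implicit Types (x y v w : 'rV[R]_n).

(** First and second derivatives of [w = h (u)] along a line, the second at parameter 0. Summed over
    an orthonormal basis, [wline2] gives [f p (|grad w|^2 - 1)] by the equation for [u], that is,
    the equation for [w]. *)
Let wline1 x v (s : R) := p (u (x + s *: v)) * gradient_dot u (x + s *: v) v.
Let wline2 x v := f (u x) * p (u x) * (p (u x) * gradient_dot u x v) ^+ 2
   + p (u x) * hessian u x v.

Lemma is_derive_wline x v (s : R) :
  is_derive s 1 (fun t => h (u (x + t *: v))) (wline1 x v s).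
Proof. exact: (is_derive_compE (dh _) (class_C_line1 x v _ (class_CS Cu))). Qed.

Lemma is_derive_wline1 x v : is_derive (0 : R) 1 (wline1 x v) (wline2 x v).
Proof.
rewrite -[X in wline2 X]addr0 -[X in wline2 (x + X)](scale0r v).
apply: is_derive_eqE; last first.
  apply: is_derive_mulE; last exact: class_C_line2.
  exact: (is_derive_compE (dp _) (class_C_line1 x v _ (class_CS Cu))).
by rewrite /wline2; ring.
Qed.

Variables (psi psi1 psi2 : R -> R) (eps : R) (x y : 'rV[R]_n).
Hypotheses (dpsi : forall r : R, is_derive r 1 psi (psi1 r))
  (dpsi1 : forall r : R, is_derive r 1 psi1 (psi2 r))
  (psi_nd : forall r s : R, r <= s -> psi r <= psi s).
Let Z x y := h (u x) - h (u y) - psi (euclid_norm (x - y)) - eps * dotr x x.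
Hypothesis Zmax : forall x' y', Z x' y' <= Z x y.
Let r := euclid_norm (x - y).

(** The distance is replaced by a quadratic majorant that is exact at [s = 0]. As [psi] is
    nondecreasing, the modified function stays below [Z] and touches it at 0, so it also has a
    maximum there, and the norm itself is never differentiated. The conclusions are the first and
    second order conditions. *)
Lemma two_point_variation v w (a b d : R) : 0 < d ->
  (forall s, `|s| < d -> euclid_norm (x - y + s *: (v - w)) <= r + a * s + b *
    s ^+ 2) ->
  p (u x) * gradient_dot u x v - p (u y) * gradient_dot u y w - psi1 r * a
    - 2 * eps * dotr x v = 0 /\
  wline2 x v - wline2 y w - (psi2 r * a ^+ 2 + 2 * b * psi1 r)
    - 2 * eps * dotr v v <= 0.
Proof.
move=> d0 Hd.
pose rho (s : R) := r + a * s + b * s ^+ 2.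
pose rho1 (s : R) := a + 2 * b * s.
have drho (s : R) : is_derive s 1 rho (rho1 s).
  by apply: is_derive_eqE; rewrite /rho1 /GRing.scale/=; ring.
have drho1 (s : R) : is_derive s 1 rho1 (2 * b).
  by apply: is_derive_eqE; rewrite /GRing.scale/=; ring.
pose g (s : R) := h (u (x + s *: v)) - h (u (y + s *: w)) - psi (rho s)
  - eps * (dotr x x + 2 * dotr x v * s + dotr v v * s ^+ 2).
pose g1 (s : R) := wline1 x v s - wline1 y w s - psi1 (rho s) * rho1 s
  - eps * (2 * dotr x v + 2 * dotr v v * s).
have dg (s : R) : is_derive s 1 g (g1 s).
  have dq : is_derive s 1 (fun s : R => eps * (dotr x x + 2 * dotr x v * s +
    dotr v v * s ^+ 2))
      (eps * (2 * dotr x v + 2 * dotr v v * s)).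
    by apply: is_derive_eqE; rewrite /GRing.scale/=; ring.
  exact: (is_derive_subE (is_derive_subE (is_derive_subE (is_derive_wline x v s)
    (is_derive_wline y w s)) (is_derive_compE (dpsi _) (drho s))) dq).
have rho0 : rho 0 = r by rewrite /rho; ring.
have rho10 : rho1 0 = a by rewrite /rho1; ring.
have dg1 : is_derive (0 : R) 1 g1 (wline2 x v - wline2 y w - (psi2 r * a ^+ 2
  + 2 * b * psi1 r)
    - 2 * eps * dotr v v).
  have dq : is_derive (0 : R) 1 (fun s : R =>
    eps * (2 * dotr x v + 2 * dotr v v * s))
      (2 * eps * dotr v v).
    by apply: is_derive_eqE; rewrite /GRing.scale/=; ring.
  have dpr : is_derive (0 : R) 1 (fun s : R => psi1 (rho s) * rho1 s)
      (psi2 r * a ^+ 2 + 2 * b * psi1 r).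
    apply: is_derive_eqE (is_derive_mulE (is_derive_compE (dpsi1 _) (drho 0))
      (drho1 0)).
    by rewrite rho0 rho10; ring.
  exact: (is_derive_subE (is_derive_subE (is_derive_subE (is_derive_wline1 x v)
    (is_derive_wline1 y w)) dpr) dq).
have gmax s : `|s| < d -> g s <= g 0.
  move=> sd; have := Zmax (x + s *: v) (y + s *: w).
  have -> : Z x y = g 0.
    by rewrite /g /Z rho0 !scale0r !addr0 mulr0 expr0n/= mulr0 !addr0.
  apply: le_trans; rewrite /g /Z.
  have -> : dotr x x + 2 * dotr x v * s + dotr v v * s ^+ 2 = dotr (x + s *:
    v) (x + s *: v).
    rewrite !dotrDl !dotrDr !dotrZl !dotrZr (dotrC v x); ring.
  rewrite lerD2r lerD2l lerN2; apply: psi_nd.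
  have -> : x + s *: v - (y + s *: w) = x - y + s *: (v - w).
    by rewrite opprD addrACA scalerBr.
  exact: Hd.
have [E H] := second_derivative_at_max dg dg1 d0 gmax.
split=> //; move: E; rewrite /g1 /wline1 !scale0r !addr0 rho0 rho10 => <-.
by rewrite mulr0 addr0; ring.
Qed.

Hypothesis r0 : 0 < r.
Let e := r^-1 *: (x - y).
Let eE i : e ord0 i = (x - y) ord0 i / r. Proof. by rewrite mxE mulrC. Qed.

Let dotee : dotr e e = 1.
Proof.
rewrite dotrZl dotrZr -sqr_euclid_norm -/r; field; exact: lt0r_neq0.
Qed.

Lemma gradient_dot_delta (g : 'rV[R]_n -> R) z i :
  gradient_dot g z (delta_mx ord0 i) = partial i g z.
Proof. exact: (sum_delta_mx (fun j => partial j g z)). Qed.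

Lemma gradient_dot0 z : gradient_dot u z 0 = 0.
Proof. by apply: big1 => i _; rewrite mxE mul0r. Qed.

(** With [k = |z|] and [q = |z + s w|], the inequality [(q - k)^2 >= 0] reads
    [q <= (q^2 + k^2) / (2 k)], whose right-hand side is a polynomial in [s]. *)
Let norm_shift z (s : R) : 0 < euclid_norm z -> forall w, dotr w w = 1 ->
  euclid_norm (z + s *: w) <=
    euclid_norm z + dotr z w / euclid_norm z * s + (2 * euclid_norm z)^-1 * s
      ^+ 2.
Proof.
move=> z0 w w1; set q := _ + s *: w; set k := euclid_norm z.
have q2 : euclid_norm q ^+ 2 = k ^+ 2 + 2 * s * dotr z w + s ^+ 2.
  rewrite sqr_euclid_norm /k sqr_euclid_norm /q !dotrDl !dotrDr !dotrZl
    !dotrZr w1 (dotrC w z).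
  ring.
have -> : k + dotr z w / k * s + (2 * k)^-1 * s ^+ 2 = (euclid_norm q ^+ 2 + k
  ^+ 2) / (2 * k).
  rewrite q2; field; exact: lt0r_neq0.
rewrite ler_pdivlMr ?mulr_gt0//; have := sqr_ge0 (euclid_norm q - k).
rewrite sqrrB; lra.
Qed.

Lemma two_point_gradient_x i :
  p (u x) * partial i u x = psi1 r * e ord0 i + 2 * eps * x ord0 i.
Proof.
have [|H _] := @two_point_variation (delta_mx ord0 i) 0 (e ord0 i) (2 * r)^-1
  1 ltr01.
  move=> s _; rewrite subr0 eE -[(x - y) ord0 i]dotr_delta;
    apply: norm_shift => //.
  by rewrite dotr_delta mxE !eqxx.
move: H; rewrite gradient_dot0 gradient_dot_delta dotr_delta mulr0 subr0.
move/eqP; rewrite subr_eq0 => /eqP <-; ring.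
Qed.

Lemma two_point_gradient_y i :
  p (u y) * partial i u y = psi1 r * e ord0 i.
Proof.
have [|H _] := @two_point_variation 0 (delta_mx ord0 i) (- e ord0 i) (2 *
  r)^-1 1 ltr01.
  move=> s _; rewrite sub0r.
  have -> : - e ord0 i = dotr (x - y) (- delta_mx ord0 i) / r.
    by rewrite dotrC dotrNl dotrC dotr_delta eE mulNr.
  by apply: norm_shift => //; rewrite dotrNl dotrC dotrNl opprK dotr_delta mxE
    !eqxx.
move: H; rewrite gradient_dot0 gradient_dot_delta dotrC.
have -> : dotr 0 x = 0 by apply: big1 => j _; rewrite mxE mul0r.
rewrite !mulr0 sub0r subr0 mulrN opprK => /eqP;
  rewrite addrC subr_eq0 => /eqP <-.
by [].
Qed.

(* Moving x along the basis and y along its reflected image leaves only [psi'']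
   from the distance; the reflection does not change the trace of the Hessian.
     *)
Let refl i : 'rV[R]_n := delta_mx ord0 i - (2 * e ord0 i) *: e.

(** The difference of the two directions is [2 e_i e], so the points separate along the line through
    them and their distance is exactly [r + 2 e_i s], with no quadratic term and hence no
    contribution of [psi']. The restriction [|s| < r / 2] keeps this expression nonnegative. *)
Lemma two_point_hessian i :
  wline2 x (delta_mx ord0 i) - wline2 y (refl i) - psi2 r * (2 * e ord0 i) ^+
    2 - 2 * eps <= 0.
Proof.
have r2 : 0 < r / 2 by rewrite divr_gt0.
have [|_] := @two_point_variation (delta_mx ord0 i) (refl i) (2 * e ord0 i) 0
  (r / 2) r2.
  move=> s sr; rewrite mul0r addr0 /refl subKr.
  have -> : x - y = r *: e by rewrite scalerA divff ?scale1r// gt_eqF.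
  rewrite [s *: _]scalerA -scalerDl euclid_normZ euclid_normE dotee sqrtr1
    mulr1.
  rewrite ger0_norm; first by rewrite [s * _]mulrC.
  have ei : `|e ord0 i| <= 1.
    by apply: le_trans (coord_le_euclid_norm e i) _;
      rewrite euclid_normE dotee sqrtr1.
  have : `|s * (2 * e ord0 i)| <= r.
    rewrite mulrCA normrM ger0_norm// normrM.
    have : `|s| * `|e ord0 i| <= r / 2 * 1 by apply: ler_pM => //; exact: ltW.
    lra.
  by rewrite ler_norml => /andP[]; lra.
have dd : dotr (delta_mx ord0 i : 'rV[R]_n) (delta_mx ord0 i) = 1
  by rewrite dotr_delta mxE !eqxx.
by rewrite mulr0 mul0r addr0 dd mulr1.
Qed.

Let sum_indicator (c : 'I_n -> R) j : \sum_(i < n) (i == j)%:R * c i = c j.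
Proof.
rewrite (bigD1 j)//= eqxx mul1r big1 ?addr0// => i /negPf ->.
by rewrite mul0r.
Qed.

Let reflE i j : refl i ord0 j = (i == j)%:R - 2 * e ord0 i * e ord0 j.
Proof. by rewrite /refl; move: e => e'; rewrite !mxE eqxx eq_sym. Qed.

Let refl_orthogonal j k :
  \sum_(i < n) refl i ord0 j * refl i ord0 k = (j == k)%:R.
Proof.
have -> : \sum_(i < n) refl i ord0 j * refl i ord0 k = \sum_(i < n)
    ((i == j)%:R * (i == k)%:R - (i == j)%:R * (2 * e ord0 k * e ord0 i)
     - (i == k)%:R * (2 * e ord0 j * e ord0 i)
     + 4 * e ord0 j * e ord0 k * (e ord0 i * e ord0 i)).
  by apply: eq_bigr => i _; rewrite !reflE; ring.
rewrite big_split !sumrB -mulr_sumr -/(dotr e e) dotee !sum_indicator.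
by rewrite /=; ring.
Qed.

Lemma sum_hessian_refl : \sum_(i < n) hessian u y (refl i) = laplacian u y.
Proof.
have key (H : 'I_n -> 'I_n -> R) :
    \sum_(i < n) \sum_(j < n) refl i ord0 j * \sum_(k < n) refl i ord0 k * H j
      k =
    \sum_(j < n) H j j.
  rewrite exchange_big; apply: eq_bigr => j _.
  under eq_bigr do rewrite mulr_sumr.
  rewrite exchange_big -[RHS](sum_indicator (H j)); apply: eq_bigr => k _.
  under eq_bigr do rewrite mulrA.
  by rewrite -mulr_suml refl_orthogonal eq_sym.
exact: (key (fun j k => partial k (partial j u) y)).
Qed.

(** Summing [two_point_hessian] over [i], the squares [(2 e_i)^2] add up to 4 and the equation turns
    both traces into [f p (|grad w|^2 - 1)]. The squared gradient is [psi'^2] at [y], and at [x] up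
    to the gradient of the penalty, whence the terms in [eps |x|]. *)
Lemma two_point_inequality : 0 <= eps -> 0 <= psi1 r ->
  - 4 * psi2 r <= 2 * eps * n%:R +
    B * (2 * `|psi1 r ^+ 2 - 1| + 4 * psi1 r * (eps * euclid_norm x) + 4 *
      (eps * euclid_norm x) ^+ 2).
Proof.
move=> eps0 psi10.
set P1 := psi1 r.
(* The gradient of [w] at [y] is [psi' e], and the reflection sends [e] to [- e]; the sign
   disappears in the squares. *)
have gy i : p (u y) * gradient_dot u y (refl i) = - P1 * e ord0 i.
  have -> : p (u y) * gradient_dot u y (refl i) = \sum_j refl i ord0 j * (P1 *
    e ord0 j).
    by rewrite mulr_sumr; apply: eq_bigr => j _;
      rewrite mulrCA two_point_gradient_y.
  have -> : \sum_j refl i ord0 j * (P1 * e ord0 j) = P1 * dotr (refl i) e.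
    by rewrite mulr_sumr; apply: eq_bigr => j _; rewrite mulrCA.
  rewrite /refl dotrDl dotrNl dotrZl dotee dotrC dotr_delta; ring.
have hx i : hessian u x (delta_mx ord0 i) = partial i (partial i u) x.
  rewrite -gradient_dot_delta.
  exact: (sum_delta_mx (fun j => gradient_dot (partial j u) x _)).
set fx := f (u x) * p (u x); set fy := f (u y) * p (u y).
set S := dotr (P1 *: e + (2 * eps) *: x) (P1 *: e + (2 * eps) *: x).
have sumx : \sum_(i < n) wline2 x (delta_mx ord0 i) = fx * S - fx.
  rewrite /wline2 big_split/=; congr (_ + _).
    rewrite -mulr_sumr; congr (_ * _); apply: eq_bigr => i _.
    by rewrite gradient_dot_delta two_point_gradient_x !mxE expr2.
  under eq_bigr do rewrite hx.
  by rewrite -mulr_sumr -/(laplacian u x) /fx -solu; ring.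
have sumy : \sum_(i < n) wline2 y (refl i) = fy * P1 ^+ 2 - fy.
  rewrite /wline2 big_split/=; congr (_ + _).
    rewrite -mulr_sumr; congr (_ * _).
    under eq_bigr do rewrite gy exprMn sqrrN expr2 [e _ _ ^+ 2]expr2.
    by rewrite -mulr_sumr -/(dotr e e) dotee mulr1 expr2.
  by rewrite -mulr_sumr sum_hessian_refl /fy -solu; ring.
have gen (F G : 'I_n -> R) c c' :
    \sum_(i < n) (F i - G i - c * (2 * e ord0 i) ^+ 2 - c') =
    \sum_(i < n) F i - \sum_(i < n) G i - 4 * c - c' * n%:R.
  rewrite !sumrB sumr_const card_ord mulr_natr; congr (_ - _ - _).
  under eq_bigr do rewrite exprMn [e _ _ ^+ 2]expr2 mulrA.
  rewrite -mulr_sumr -/(dotr e e) dotee; ring.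
have H : fx * S - fx - (fy * P1 ^+ 2 - fy) - 4 * psi2 r - 2 * eps * n%:R <= 0.
  rewrite -sumx -sumy -(gen (fun i => wline2 x (delta_mx ord0 i)) (fun i =>
    wline2 y (refl i))).
  by apply: sumr_le0 => i _; exact: two_point_hessian.
set X := euclid_norm x.
have SE : S = P1 ^+ 2 + 4 * P1 * eps * dotr e x + 4 * (eps * X) ^+ 2.
  rewrite /S; move: e dotee => z zz.
  rewrite !dotrDl !dotrDr !dotrZl !dotrZr zz (dotrC x z) exprMn
    sqr_euclid_norm; ring.
have ex : `|dotr e x| <= X.
  by apply: le_trans (Cauchy_Schwarz e x) _;
    rewrite {1}euclid_normE dotee sqrtr1 mul1r.
have B0 : 0 <= B := le_trans (normr_ge0 _) (fpB x).
have Bx : `|fx * (S - 1)| <= B * (`|P1 ^+ 2 - 1| + 4 * P1 * (eps * X) + 4 *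
  (eps * X) ^+ 2).
  rewrite normrM; apply: ler_pM; rewrite ?normr_ge0//; first exact: fpB.
  have -> : S - 1 = (P1 ^+ 2 - 1) + 4 * P1 * eps * dotr e x + 4 * (eps * X) ^+
    2.
    by rewrite SE; ring.
  apply: le_trans (ler_normD _ _) _; apply: lerD;
    last by rewrite ger0_norm// mulr_ge0// sqr_ge0.
  apply: le_trans (ler_normD _ _) _; rewrite lerD2l normrM ger0_norm
    ?mulr_ge0//.
  rewrite -[leLHS]mulrA; apply: ler_wpM2l; first exact: mulr_ge0.
  exact: ler_wpM2l.
have By : `|fy * (P1 ^+ 2 - 1)| <= B * `|P1 ^+ 2 - 1|.
  by rewrite normrM ler_wpM2r//; exact: fpB.
exact: two_point_arith H (lerNnormlW Bx) (ler_normlW By).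
Qed.

End two_point.

(** * Existence of a maximum on the unbounded space *)

Lemma compact_norm_le (R : realType) (n : nat) (B : R) :
  compact [set x : 'rV[R]_n | `|x| <= B].
Proof.
apply: bounded_closed_compact.
  exists B; split; first exact: num_real.
  by move=> M NM x /le_trans; apply; exact: ltW.
apply: (@preimage_closed _ _ _ [set y : R | y <= B]).
  by move=> x _; exact: norm_continuous.
exact: closed_le.
Qed.

Lemma continuous_bounded_on_ball (R : realType) (n : nat) (g : 'rV[R]_n ->
  R) (B : R) :
  continuous g -> 0 <= B -> exists2 C, 0 <= C & forall x, `|x| <= B ->
    `|g x| <= C.
Proof.
move=> cg B0.
have cg' : continuous (fun x => `|g x|).
  by move=> x; apply: (@continuous_comp _ _ _ g (fun z : R => `|z|));
    [exact: cg|exact: norm_continuous].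
have [|c _ Hc] := @compact_EVT_max _ R (fun x =>
  `|g x|) [set x : 'rV[R]_n | `|x| <= B] _
    (@compact_norm_le R n B) (continuous_subspaceT cg').
  by exists 0; rewrite /= normr0.
by exists `|g c| => // x xB; apply: Hc; exact: mem_set.
Qed.

(** Positive values of [Z] occur only in a compact set: the penalty confines [x], and [psi r >= r]
    confines [x - y] since [W] is bounded. This is why a penalty in [x] alone suffices. *)
Lemma penalised_max (R : realType) (n : nat) (W : 'rV[R]_n -> R) (psi : R -> R)
    (L eps : R) (x1 y1 : 'rV[R]_n) :
  continuous W -> continuous psi -> (forall x, `|W x| <= L) ->
  (forall r : R, 0 <= r -> r <= psi r) -> 0 < eps ->
  let Z x y := W x - W y - psi (euclid_norm (x - y)) - eps * dotr x x in
  0 < Z x1 y1 -> exists x y, forall x' y', Z x' y' <= Z x y.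
Proof.
move=> cW cpsi WL psir eps0 Z Z1.
have WW x y : W x - W y <= 2 * L.
  have := WL x; have := WL y; rewrite !ler_norml => /andP[? ?] /andP[? ?]; lra.
have L0 : 0 <= L := le_trans (normr_ge0 _) (WL x1).
(* Chosen so that both [N] and [eps N^2] dominate the oscillation [2 L]; [N >= 1] gives the second
   from [eps N >= 2 L]. *)
pose N := 1 + 2 * L + 2 * L / eps.
have N1 : 1 <= N by rewrite /N -addrA lerDl addr_ge0 ?divr_ge0 ?mulr_ge0// ltW.
have N2 : 2 * L <= N.
  have : 0 <= 2 * L / eps by rewrite divr_ge0 ?mulr_ge0// ltW.
  rewrite /N; lra.
have N3 : 2 * L <= eps * N ^+ 2.
  have H : 2 * L <= eps * N.
    rewrite [eps * _]mulrC -ler_pdivrMr// /N; lra.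
  apply: le_trans H _; rewrite ler_pM2l// expr2 ler_peMr//; lra.
have Zneg x y : N < euclid_norm x \/ N < euclid_norm (x - y) -> Z x y <= 0.
  rewrite /Z => H; have r0 := psir _ (euclid_norm_ge0 (x - y)).
  have e0 := euclid_norm_ge0 (x - y).
  have := WW x y; have [|] := H.
    move=> Nx; have : eps * N ^+ 2 <= eps * dotr x x.
      by rewrite ler_pM2l// -sqr_euclid_norm ler_pXn2r ?nnegrE
        ?euclid_norm_ge0 ?ltW//; lra.
    lra.
  have : 0 <= eps * dotr x x by rewrite mulr_ge0 ?dotr_ge0// ltW.
  lra.
pose K := [set x : 'rV[R]_n | `|x| <= 2 * N].
have cK : compact K := @compact_norm_le R n (2 * N).
have cZ : continuous (fun p : 'rV[R]_n * 'rV[R]_n => Z p.1 p.2).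
  move=> p; apply: cvgB; last first.
    apply: cvgMl_tmp; apply: (@continuous_comp _ _ _ fst (fun x => dotr x x)).
      exact: cvg_fst.
    exact: continuous_dotr.
  apply: cvgB.
    apply: cvgB.
      by apply: (@continuous_comp _ _ _ fst W); [exact: cvg_fst|exact: cW].
    by apply: (@continuous_comp _ _ _ snd W); [exact: cvg_snd|exact: cW].
  apply: (@continuous_comp _ _ _ (fun p : 'rV[R]_n * 'rV[R]_n =>
    euclid_norm (p.1 - p.2)) psi); last exact: cpsi.
  apply: (@continuous_comp _ _ _ (fun p : 'rV[R]_n * 'rV[R]_n =>
    p.1 - p.2) (@euclid_norm R n)).
    by apply: cvgB; [exact: cvg_fst|exact: cvg_snd].
  exact: continuous_euclid_norm.
have in1 x y : 0 < Z x y -> K x /\ K y.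
  move=> Zxy.
  have xN : euclid_norm x <= N.
    by rewrite leNgt; apply/negP => H; have := Zneg x y (or_introl H);
      rewrite leNgt Zxy.
  have xyN : euclid_norm (x - y) <= N.
    by rewrite leNgt; apply/negP => H; have := Zneg x y (or_intror H);
      rewrite leNgt Zxy.
  have xN' := le_trans (norm_le_euclid_norm x) xN.
  have xyN' := le_trans (norm_le_euclid_norm (x - y)) xyN.
  split; rewrite /K/=; first lra.
  have : `|y| <= `|x| + `|x - y| by rewrite -{1}[y](subKr x); exact: ler_normB.
  lra.
have [Kx1 Ky1] := in1 _ _ Z1.
have [[x y] /set_mem[/= Kx Ky] Hmax] := @compact_EVT_max _ R (fun p : 'rV[R]_n
  * 'rV[R]_n => Z p.1 p.2)
  (K `*` K) (ex_intro _ (x1, y1) (conj Kx1 Ky1)) (compact_setX cK cK)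
  (continuous_subspaceT cZ).
exists x, y => x' y'.
have Z1max : Z x1 y1 <= Z x y by apply: (Hmax (x1, y1)); apply/mem_set.
have [Z0|Z0] := leP (Z x' y') 0; first by apply: le_trans Z0 (ltW _);
  exact: lt_le_trans Z1max.
have [Kx' Ky'] := in1 _ _ Z0.
by apply: (Hmax (x', y')); apply/mem_set.
Qed.

Lemma is_derive_continuous (R : realType) (g g' : R -> R) :
  (forall x : R, is_derive x 1 g (g' x)) -> continuous g.
Proof.
move=> dg x; apply/differentiable_continuous/derivable1_diffP.
by have [] := dg x.
Qed.

(* For [psi r = r + del / kap * (1 - exp (- kap * r))] the term [4 psi''] at a
   maximum beats [2 B (psi' ^ 2 - 1)] as soon as [kap > B (2 + del) / 2]. *)
Theorem two_point_bound (R : realType) (n : nat) (u : 'rV[R]_n -> R)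
    (f h p : R -> R) (L B : R) :
  class_C 2 u -> (forall x, - laplacian u x = f (u x)) ->
  (forall y : R, is_derive y 1 h (p y)) ->
  (forall y : R, is_derive y 1 p (f y * p y ^+ 3)) ->
  (forall x, `|h (u x)| <= L) -> (forall x, `|f (u x) * p (u x)| <= B) ->
  forall x y, h (u x) - h (u y) <= euclid_norm (x - y).
Proof.
move=> Cu solu dh dp hL fpB x1 y1; rewrite leNgt; apply/negP => H1.
have L0 : 0 <= L := le_trans (normr_ge0 _) (hL x1).
have B0 : 0 <= B := le_trans (normr_ge0 _) (fpB x1).
(* Half of the excess: replacing [r] by [psi r] costs at most [del] and the penalty at most
   [del / 2], so [Z] stays positive at the initial pair. *)
pose del := (h (u x1) - h (u y1) - euclid_norm (x1 - y1)) / 2.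
have del0 : 0 < del by rewrite divr_gt0// subr_gt0.
have m1 : h (u x1) - h (u y1) = euclid_norm (x1 - y1) + 2 * del
  by rewrite /del; field.
pose kap := B * (2 + del) + 1.
have kap1 : 1 <= kap by rewrite lerDr mulr_ge0// addr_ge0// ltW.
have kap0 : 0 < kap by lra.
pose E r := expR (- kap * r).
have E0 r : 0 < E r := expR_gt0 _.
have dE (r : R) : is_derive r 1 E (- kap * E r).
  have dl : is_derive r 1 (fun r : R => - kap * r) (- kap).
    by apply: is_derive_eqE; rewrite /GRing.scale/= mulr1.
  by apply: is_derive_eqE (is_derive_compE (is_derive_expR _) dl);
    rewrite mulrC.
pose psi r := r + del / kap * (1 - E r).
pose psi1 r := 1 + del * E r.
pose psi2 r := - (kap * del * E r).
have dpsi (r : R) : is_derive r 1 psi (psi1 r).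
  apply: is_derive_eqE (is_derive_addE (is_derive_idE r) (is_derive_scaleE
    (del / kap)
    (is_derive_subE (is_derive_cstE 1 _ _) (dE r)))).
  by rewrite /psi1; field; rewrite gt_eqF.
have dpsi1 (r : R) : is_derive r 1 psi1 (psi2 r).
  apply: is_derive_eqE (is_derive_addE (is_derive_cstE 1 _ _)
    (is_derive_scaleE del (dE r))).
  by rewrite /psi2; ring.
have psi10 r : 0 < psi1 r by rewrite /psi1 ltr_wpDr// ltW// mulr_gt0.
have psi_nd (r s : R) : r <= s -> psi r <= psi s.
  move=> rs; have [c _] := is_derive_MVT dpsi rs.
  by rewrite -subr_ge0 => ->; rewrite mulr_ge0 ?subr_ge0// ltW.
have E1 r : 0 <= r -> E r <= 1.
  by move=> r0; rewrite /E -expR0 ler_expR mulNr oppr_le0 mulr_ge0// ltW.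
have psi_ge r : 0 <= r -> r <= psi r.
  by move=> r0; rewrite lerDl mulr_ge0 ?subr_ge0 ?E1// divr_ge0// ltW.
have psi_le r : psi r <= r + del.
  rewrite lerD2l mulrAC ler_pdivrMr// ler_pM2l//.
  have := E0 r; lra.
(* A positive [Z] forces [r <= 2 L], so [e0] bounds [psi' - 1] from below at the maximum,
   independently of [eps]. *)
pose e0 := del * E (2 * L).
have e00 : 0 < e0 by rewrite mulr_gt0.
(* At the maximum [eps |x|^2 <= 2 L <= Lam^2], so [Lam] bounds [sqrt eps |x|]. *)
pose Lam := 1 + 2 * L.
pose C := 2 * n%:R + B * (4 * (1 + del) * Lam + 4 * Lam ^+ 2).
have C0 : 0 <= C.
  rewrite addr_ge0 ?mulr_ge0// addr_ge0 ?mulr_ge0 ?sqr_ge0// /Lam; lra.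
pose D := dotr x1 x1; have D0 : 0 <= D := dotr_ge0 x1.
(* With [eps = sig^2], the product [eps |x|] is at most [sig Lam], and all errors together are at
   most [C sig]. The second entry puts this below [e0]; the third keeps the penalty at [x1] below
   [del / 2]. *)
pose sig := Num.min 1 (Num.min (e0 / (C + 1)) (del / (1 + D) / 2)).
have C1 : 0 < C + 1 by lra.
have D1 : 0 < 1 + D by lra.
have sig0 : 0 < sig by rewrite /sig !lt_min ltr01 (divr_gt0 e00 C1) (divr_gt0
  (divr_gt0 del0 D1) (ltr0Sn R 1)).
have sig1 : sig <= 1 by rewrite ge_min lexx.
have sigC : sig * (C + 1) <= e0.
  by rewrite -ler_pdivlMr// !ge_min lexx orbT.
have sigD : sig * (1 + D) <= del / 2.
  by rewrite -ler_pdivlMr// mulrAC !ge_min lexx !orbT.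
pose eps := sig ^+ 2.
have eps0 : 0 < eps by rewrite exprn_gt0.
have epss : eps <= sig by rewrite /eps expr2 ler_piMr// ltW.
pose Z x y := h (u x) - h (u y) - psi (euclid_norm (x - y)) - eps * dotr x x.
have Z1 : 0 < Z x1 y1.
  rewrite /Z m1 -/D.
  have : eps * D <= sig * D by rewrite ler_wpM2r.
  have := psi_le (euclid_norm (x1 - y1)); nra.
have cW : continuous (fun x => h (u x)).
  move=> x; apply: (@continuous_comp _ _ _ u h); first by case: Cu => + _;
    exact.
  exact: (is_derive_continuous dh).
have [x [y Zmax]] := penalised_max cW (is_derive_continuous dpsi) hL psi_ge
  eps0 Z1.
have Zxy : 0 < Z x y := lt_le_trans Z1 (Zmax x1 y1).
have eD : 0 <= eps * dotr x x by rewrite mulr_ge0 ?dotr_ge0// ltW.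
pose r := euclid_norm (x - y).
have r_ge0 : 0 <= r := euclid_norm_ge0 _.
have r0 : 0 < r.
  rewrite lt_neqAle r_ge0 andbT eq_sym;
    apply/eqP => /euclid_norm0_eq0/subr0_eq xy.
  have := Zxy; rewrite /Z xy !subrr sub0r.
  have := psi_ge 0 (lexx _); rewrite (_ : euclid_norm 0 = 0); last first.
    by rewrite -[0 in LHS](scale0r (0 : 'rV[R]_n)) euclid_normZ normr0 mul0r.
  rewrite -xy; lra.
have WL : h (u x) - h (u y) <= 2 * L.
  have := hL x; have := hL y; rewrite !ler_norml => /andP[? ?] /andP[? ?]; lra.
have psi0 := psi_ge r r_ge0.
have Zxy' := Zxy; rewrite /Z -/r in Zxy'.
have rL : r <= 2 * L by lra.
have eDL : eps * dotr x x <= 2 * L by lra.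
have := two_point_inequality Cu solu dh dp fpB dpsi dpsi1 psi_nd Zmax r0 (ltW
  eps0) (ltW (psi10 _)).
rewrite -/r; set X := euclid_norm x; set T := E r => Hin.
have X0 : 0 <= X := euclid_norm_ge0 x.
have sX : sig * X <= Lam.
  rewrite -(@ler_pXn2r _ 2)// ?nnegrE ?mulr_ge0 ?(ltW sig0)//;
    last by rewrite /Lam; lra.
  rewrite exprMn /X sqr_euclid_norm; apply: le_trans eDL _; rewrite /Lam; nra.
have eX : eps * X <= sig * Lam by rewrite /eps expr2 -mulrA ler_pM2l.
have eX0 : 0 <= eps * X by rewrite mulr_ge0// ltW.
have T1 : T <= 1 := E1 _ r_ge0.
have T0 : 0 < T := E0 _.
have Te : e0 <= del * T.
  by rewrite ler_pM2l// ler_expR !mulNr lerN2 ler_pM2l.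
set eta := del * T in Te *.
have eta1 : eta <= del by rewrite /eta ger_pMr.
have eta0 : 0 < eta by rewrite mulr_gt0.
have Lam0 : 0 <= Lam by rewrite /Lam; lra.
have abs : `|psi1 r ^+ 2 - 1| <= eta * (2 + del).
  rewrite /psi1 -/T -/eta ger0_norm; nra.
have t2 : 4 * psi1 r * (eps * X) <= 4 * (1 + del) * Lam * sig.
  rewrite -[4 * (1 + del) * Lam * sig]mulrA [Lam * sig]mulrC;
    apply: ler_pM => //.
    by rewrite mulr_ge0// ltW.
  by rewrite ler_pM2l// lerD2l.
have t3 : (eps * X) ^+ 2 <= Lam ^+ 2 * sig.
  apply: (@le_trans _ _ ((sig * Lam) ^+ 2)).
    by rewrite ler_pXn2r// nnegrE// mulr_ge0// ltW.
  by rewrite exprMn mulrC ler_wpM2l ?sqr_ge0.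
have t1 : 2 * eps * n%:R <= 2 * n%:R * sig.
  by rewrite mulrAC ler_wpM2l// mulr_ge0.
have t4 : B * (2 * `|psi1 r ^+ 2 - 1| + 4 * psi1 r * (eps * X) + 4 * (eps * X)
  ^+ 2)
   <= B * (2 * (eta * (2 + del)) + (4 * (1 + del) * Lam + 4 * Lam ^+ 2) * sig).
  apply: ler_wpM2l => //; lra.
(* Here [eta = psi' - 1]. The left side of the inequality is [4 B eta (2 + del) + 4 eta], the right
   side at most [2 B eta (2 + del) + C sig], while [C sig < e0 <= eta]: a contradiction. *)
have : - 4 * psi2 r = 4 * kap * eta by rewrite /psi2 -/T /eta; ring.
have : 4 * kap * eta = 4 * (B * (eta * (2 + del))) + 4 * eta by rewrite /kap;
  ring.
have : 0 <= B * (eta * (2 + del)) by rewrite !mulr_ge0 ?(ltW eta0)//; lra.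
have : C * sig = 2 * n%:R * sig + B * ((4 * (1 + del) * Lam + 4 * Lam ^+ 2) *
  sig).
  by rewrite /C; ring.
have : B * (2 * (eta * (2 + del)) + (4 * (1 + del) * Lam + 4 * Lam ^+ 2) *
  sig) =
    2 * (B * (eta * (2 + del))) + B * ((4 * (1 + del) * Lam + 4 * Lam ^+ 2) *
      sig).
  by ring.
have : sig * (C + 1) = C * sig + sig by ring.
move: (B * ((4 * (1 + del) * Lam + 4 * Lam ^+ 2) * sig)) (B * (eta * (2 +
  del))) t4 => ? ?.
lra.
Qed.

(** * Travel times, layer solutions and the cone *)

Lemma continuous_bounded_on_segment (R : realType) (g : R -> R) (K : R) :
  continuous g -> 0 <= K -> exists B, forall y, `|y| <= K -> `|g y| <= B.
Proof.
move=> cg K0; have KK : - K <= K by lra.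
have [|c _ Hc] := @EVT_max R (fun y => `|g y|) (- K) K KK.
  by apply: continuous_subspaceT => y; apply: (@continuous_comp _ _ _ g (fun z
    : R => `|z|)); [exact: cg|exact: norm_continuous].
by exists `|g c| => y yK; apply: Hc; rewrite in_itv/= -ler_norml.
Qed.

Section travel_time.
Variables (R : realType) (f : R -> R) (M : R).
Hypotheses (cf : continuous f) (f_odd : forall y : R, f (- y) = - f y).
Hypothesis G_ge0 : forall y : R, 0 <= potential f M y.
Let G := potential f M.

Lemma is_derive_potential (y : R) : is_derive y 1 G (- f y).
Proof. exact: is_derive_oriented_integral. Qed.

Lemma potential_even (y : R) : G (- y) = G y.
Proof.
pose E z := G (- z) - G z.
have dE (z : R) : is_derive z 1 E 0.
  apply: is_derive_eqE (is_derive_subE (is_derive_compE (is_derive_potential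
    (- z))
    (is_derive_oppE (is_derive_idE z))) (is_derive_potential z)).
  by rewrite f_odd; ring.
apply/eqP; rewrite -subr_eq0 -/(E y) (is_derive_0_is_cst y 0 dE) /E oppr0.
by rewrite subrr.
Qed.

(** The reciprocal speed at position [y] when [v'^2 / 2 - G v = c]. For [c > 0] it is finite on the
    whole line, also at and beyond the zeros of [G]. *)
Definition slowness (c y : R) : R := (Num.sqrt (2 * (potential f M y + c)))^-1.

(* The time in which a solution of [v'^2 / 2 = G v + c] goes from 0 to [y]; for
   [c = 0] it inverts the layer solution. *)
Definition travel_time (c y : R) : R := - oriented_integral (slowness c) y 0.

Variable c : R.
Hypothesis c_gt0 : 0 < c.
Let p := slowness c.
Let h := travel_time c.

Let Gc_gt0 y : 0 < 2 * (G y + c).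
Proof. by rewrite mulr_gt0// ltr_wpDl// G_ge0. Qed.

Lemma slowness_gt0 y : 0 < p y.
Proof. by rewrite invr_gt0 sqrtr_gt0. Qed.

Lemma is_derive_slowness (y : R) : is_derive y 1 p (f y * p y ^+ 3).
Proof.
have dG : is_derive y 1 (fun y => 2 * (G y + c)) (- 2 * f y).
  apply: is_derive_eqE (is_derive_scaleE 2 (is_derive_addE
    (is_derive_potential y)
    (is_derive_cstE c _ _))).
  by ring.
have s0 : Num.sqrt (2 * (G y + c)) != 0 by rewrite gt_eqF// sqrtr_gt0.
have ds := @is_derive_compE _ _ Num.sqrt (fun y => 2 * (G y + c)) _ _ _ _
  (is_derive1_sqrt (Gc_gt0 y)) dG.
have dV := @is_deriveV R (fun y => Num.sqrt (2 * (G y + c))) _ _ _ s0 ds.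
apply: is_derive_eqE dV.
rewrite /p /slowness -/G; set q := Num.sqrt _ in s0 *.
by rewrite /GRing.scale/=; field.
Qed.

Lemma is_derive_travel_time (y : R) : is_derive y 1 h (p y).
Proof.
apply: is_derive_eqE (is_derive_oppE (is_derive_oriented_integral 0 y
  (is_derive_continuous is_derive_slowness))).
by rewrite opprK.
Qed.

Lemma travel_time0 : h 0 = 0.
Proof. by rewrite /h /travel_time /oriented_integral lexx set_itv1
  Rintegral_set1 oppr0. Qed.

Lemma travel_time_odd (y : R) : h (- y) = - h y.
Proof.
pose E z := h (- z) + h z.
have dE (z : R) : is_derive z 1 E 0.
  apply: is_derive_eqE (is_derive_addE (is_derive_compE (is_derive_travel_time
    (- z))
    (is_derive_oppE (is_derive_idE z))) (is_derive_travel_time z)).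
  by rewrite /p /slowness -/G potential_even; ring.
apply/eqP; rewrite -addr_eq0 -/(E y) (is_derive_0_is_cst y 0 dE) /E oppr0.
by rewrite travel_time0 addr0.
Qed.

Lemma travel_time_le (y z : R) : y <= z -> h y <= h z.
Proof.
move=> yz; have [d _] := is_derive_MVT is_derive_travel_time yz.
by rewrite -subr_ge0 => ->; rewrite mulr_ge0 ?subr_ge0// ltW// slowness_gt0.
Qed.

End travel_time.

(** * Layer solutions and their first integral *)

Section profile.
Variables (R : realType) (f : R -> R) (M : R).
Hypotheses (cf : continuous f) (f_odd : forall y : R, f (- y) = - f y).
Hypothesis G_ge0 : forall y : R, 0 <= potential f M y.
Hypotheses (G_M : potential f M M = 0) (M_gt0 : 0 < M).
Let G := potential f M.

(** A layer solution with its derivative as an explicit function. The conditions are stable under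
    [v |-> - v (- t)], so oddness can be proved by comparing two profiles. *)
Definition profile (v v1 : R -> R) : Prop :=
  [/\ forall t : R, is_derive t 1 v (v1 t), forall t : R,
    is_derive t 1 v1 (- f (v t)),
      v 0 = 0, forall t, 0 < v1 t &
      (forall t, - M < v t < M) /\ (forall y, - M < y < M ->
        exists t, v t = y)].

Lemma layer_solution_profile v : layer_solution f M v ->
  profile v v^`()%classic.
Proof.
move=> [[dv [dv1 _]] rv v0 v1 v2]; split=> // [t|t|].
- exact: is_deriveW.
- by have := is_deriveW (dv1 t); rewrite -derive1n1 -derive1nS -v2 opprK.
split=> [t|y yM].
  have : range v (v t) by exists t.
  by rewrite rv /= in_itv.
have : range v y by rewrite rv /= in_itv.
by move=> [t _ <-]; exists t.
Qed.

Lemma profile_opp v v1 : profile v v1 -> profile (fun t =>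
  - v (- t)) (fun t => v1 (- t)).
Proof.
move=> [dv dv1 v0 v1_gt0 [vM vsurj]]; split=> // [t|t||].
- apply: is_derive_eqE (is_derive_oppE (is_derive_compE (dv (- t))
  (is_derive_oppE (is_derive_idE t)))).
  by ring.
- apply: is_derive_eqE (is_derive_compE (dv1 (- t)) (is_derive_oppE
  (is_derive_idE t))).
  by rewrite f_odd; ring.
- by rewrite oppr0 v0 oppr0.
split=> [t|y]; first by have /andP[? ?] := vM (- t); apply/andP; split; lra.
move=> /andP[? ?]; have [|t tE] := vsurj (- y); first by apply/andP; split; lra.
by exists (- t); rewrite opprK tE opprK.
Qed.

(** The energy [E] is constant by the equation. If it were negative, [v1^2 = 2 G (v) + E] would be
    negative where [v] is close to [M]; if it were positive, the slope would be at least [sqrt E],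
    and [v] would reach [M] in finite time. *)
Lemma profile_first_integral v v1 t : profile v v1 -> v1 t ^+ 2 = 2 * G (v t).
Proof.
move=> [dv dv1 v0 v1_gt0 [vM vsurj]].
pose E s := v1 s ^+ 2 - 2 * G (v s).
have dE (s : R) : is_derive s 1 E 0.
  apply: is_derive_eqE (is_derive_subE (is_derive_sqrE (dv1 s))
    (is_derive_scaleE 2
    (is_derive_compE (is_derive_potential M cf (v s)) (dv s)))).
  by ring.
have Ec s : v1 s ^+ 2 = 2 * G (v s) + E 0.
  by rewrite -(is_derive_0_is_cst s 0 dE) /E; ring.
suff E0 : E 0 = 0 by rewrite Ec E0 addr0.
have [E_lt0|E_gt0|//] := ltgtP (E 0) 0.
  have e0 : 0 < - E 0 / 2 by rewrite divr_gt0// oppr_gt0.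
  have /cvgrPdist_lt/(_ _ e0)/nbhs_ballP[d /= d0 Hd] : continuous_at M G.
    exact: (is_derive_continuous (is_derive_potential M cf)).
  pose y := M - Num.min (d / 2) M.
  have m0 : 0 < Num.min (d / 2) M by rewrite lt_min M_gt0 divr_gt0.
  have mM : Num.min (d / 2) M <= M by rewrite ge_min lexx orbT.
  have md : Num.min (d / 2) M <= d / 2 by rewrite ge_min lexx.
  have [|s sE] := vsurj y; first by rewrite /y; lra.
  have : `|G M - G y| < - E 0 / 2.
    apply: Hd; rewrite /ball/= /y opprB addrC subrK gtr0_norm//; lra.
  rewrite /G G_M sub0r normrN ger0_norm ?G_ge0// -/G => Gy.
  have := sqr_ge0 (v1 s); rewrite Ec sE; lra.
pose a := Num.sqrt (E 0).
have a0 : 0 < a by rewrite sqrtr_gt0.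
have v1a s : a <= v1 s.
  rewrite -(@ler_pXn2r _ 2)// ?nnegrE ?sqrtr_ge0 ?(ltW (v1_gt0 s))//.
  by rewrite sqr_sqrtr ?(ltW E_gt0)// Ec lerDr mulr_ge0// G_ge0.
have T0 : 0 <= M / a by rewrite divr_ge0// ltW.
have [s _] := is_derive_MVT dv T0.
rewrite v0 !subr0 => vE; have /andP[_] := vM (M / a); rewrite vE.
have : a * (M / a) <= v1 s * (M / a) by rewrite ler_wpM2r.
by rewrite mulrC divfK ?gt_eqF// leNgt => /negbTE ->.
Qed.

Lemma is_derive_travel_time_profile v v1 c (t : R) : 0 < c -> profile v v1 ->
  is_derive t 1 (fun s => travel_time f M c (v s)) (v1 t / Num.sqrt (v1 t ^+ 2
    + 2 * c)).
Proof.
move=> c0 pv; have [dv _ _ _ _] := pv.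
apply: is_derive_eqE (is_derive_compE (is_derive_travel_time cf G_ge0 c0 (v
  t)) (dv t)).
by rewrite (profile_first_integral t pv) -mulrDr mulrC.
Qed.

(** The shift [c] only increases the speed: along a profile the travel time grows at rate
    [v1 / sqrt (v1^2 + 2 c)], which is at most 1. *)
Lemma travel_time_profile_le v v1 c T : 0 < c -> 0 <= T -> profile v v1 ->
  travel_time f M c (v T) <= T.
Proof.
move=> c0 T0 pv; have [_ _ v0 v1_gt0 _] := pv.
have [t _] := is_derive_MVT (fun s => is_derive_travel_time_profile s c0 pv) T0.
rewrite v0 travel_time0// !subr0 => ->; rewrite ler_piMl//.
have q0 : 0 < v1 t ^+ 2 + 2 * c by rewrite addr_gt0 ?exprn_gt0 ?mulr_gt0.
rewrite ler_pdivrMr ?sqrtr_gt0// mul1r.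
rewrite -[leLHS](gtr0_norm (v1_gt0 t)) -sqrtr_sqr; apply: ler_wsqrtr.
by rewrite lerDl mulr_ge0// ltW.
Qed.

(** If [y] exceeded [v d], it would be at least [v T] for some [T > d]; as [c] tends to 0 the travel
    time to [v T] tends to [T], which contradicts the bound [d]. The case [y >= M] is included, so
    values of [u] need not be confined beforehand. *)
Lemma le_profile v v1 d y : 0 <= d -> profile v v1 ->
  (forall c, 0 < c -> travel_time f M c y <= d) -> y <= v d.
Proof.
move=> d0 pv yd; rewrite leNgt; apply/negP => vdy.
have [dv dv1 v0 v1_gt0 [vM vsurj]] := pv.
have vlt s t : s < t -> v s < v t.
  move=> st; have [z _] := is_derive_MVT dv (ltW st).
  by rewrite -subr_gt0 => ->; rewrite mulr_gt0 ?subr_gt0.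
have [T dT vTy] : exists2 T, d < T & v T <= y.
  have [My|yM] := leP M y.
    exists (d + 1); first by rewrite ltrDl.
    by apply: le_trans My; have /andP[_ /ltW] := vM (d + 1).
  have [|T TE] := vsurj y; first by rewrite yM (lt_trans _ vdy)//;
    have /andP[] := vM d.
  exists T; last by rewrite TE.
  rewrite ltNge; apply/negP; rewrite le_eqVlt => /predU1P[Td|/vlt].
    by move: vdy; rewrite -TE Td ltxx.
  by rewrite TE ltNge (ltW vdy).
have T0 : 0 < T := le_lt_trans d0 dT.
have [|t0 _ Hmu] := @EVT_min R v1 0 T (ltW T0).
  by apply: continuous_subspaceT; exact: (is_derive_continuous dv1).
pose mu := v1 t0; have mu0 : 0 < mu := v1_gt0 t0.
have Td2 : 0 < T ^+ 2 - d ^+ 2 by rewrite subr_gt0 ltr_pXn2r// nnegrE// ltW.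
have d1 : 0 < d ^+ 2 + 1 by rewrite ltr_wpDl// sqr_ge0.
(* Small enough that [T mu / sqrt (mu^2 + 2 c) > d], where [mu] is the least slope on [[0, T]]; the
   summand 1 in the denominator covers [d = 0]. *)
pose c := mu ^+ 2 * (T ^+ 2 - d ^+ 2) / (4 * (d ^+ 2 + 1)).
have c0 : 0 < c by rewrite divr_gt0 ?mulr_gt0// exprn_gt0.
have cE : 4 * c * (d ^+ 2 + 1) = mu ^+ 2 * (T ^+ 2 - d ^+ 2).
  by rewrite /c; field; rewrite gt_eqF.
have := le_trans (travel_time_le cf G_ge0 c0 vTy) (yd c c0).
have [t /andP[t0' tT]] := is_derive_MVT (fun s =>
  is_derive_travel_time_profile s c0 pv) (ltW T0).
rewrite v0 travel_time0// !subr0 => ->.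
have mut : mu <= v1 t by apply: Hmu; rewrite in_itv/= t0' tT.
set a := v1 t in mut *; have a0 : 0 < a := lt_le_trans mu0 mut.
have q0 : 0 < a ^+ 2 + 2 * c by apply: addr_gt0;
  [exact: exprn_gt0|exact: mulr_gt0].
rewrite mulrAC ler_pdivrMr ?sqrtr_gt0//.
rewrite -(@ler_pXn2r _ 2)// ?nnegrE ?mulr_ge0 ?sqrtr_ge0 ?(ltW a0) ?(ltW T0)//.
rewrite !exprMn sqr_sqrtr ?(ltW q0)//.
have mua : mu ^+ 2 <= a ^+ 2 by rewrite ler_pXn2r// nnegrE ltW.
have : mu ^+ 2 * (T ^+ 2 - d ^+ 2) <= a ^+ 2 * (T ^+ 2 - d ^+ 2)
  by rewrite ler_pM2r.
have : 0 <= c * d ^+ 2 by rewrite mulr_ge0 ?sqr_ge0// ltW.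
lra.
Qed.

(** Both [v] and [- v (- t)] are profiles; the travel time bound along either one gives, through
    [le_profile], that the other lies above it. *)
Lemma profile_odd v v1 t : profile v v1 -> v (- t) = - v t.
Proof.
move=> pv; wlog t0 : t / 0 <= t.
  move=> H; have [/H//|/ltW] := leP 0 t.
  by rewrite -oppr_ge0 => /H; rewrite opprK => ->; rewrite opprK.
have pv' := profile_opp pv.
apply/eqP; rewrite -eqr_oppLR eq_le; apply/andP; split.
  by apply: (le_profile t0 pv) => c c0;
    exact: (travel_time_profile_le c0 t0 pv').
by apply: (le_profile t0 pv') => c c0; exact: (travel_time_profile_le c0 t0 pv).
Qed.

End profile.

(** * The distance to the Simons cone *)

Section cone_distance.
Variables (R : realType) (m : nat).
Implicit Types (x y : 'rV[R]_(m + m)) (v w : 'rV[R]_m).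

Lemma s_coordE x : s_coord x = euclid_norm (lsubmx x).
Proof. by congr Num.sqrt; apply: eq_bigr => i _; rewrite mxE. Qed.

Lemma t_coordE x : t_coord x = euclid_norm (rsubmx x).
Proof. by congr Num.sqrt; apply: eq_bigr => i _; rewrite mxE. Qed.

Lemma dotr_split x y :
  dotr x y = dotr (lsubmx x) (lsubmx y) + dotr (rsubmx x) (rsubmx y).
Proof.
by rewrite /dotr big_split_ord; congr (_ + _); apply: eq_bigr => i _;
  rewrite !mxE.
Qed.

Lemma euclid_norm_sub_ge v w : `|euclid_norm v - euclid_norm w| <= euclid_norm
  (v - w).
Proof.
have := euclid_normD (v - w) w; have := euclid_normD (w - v) v.
rewrite !subrK -[w - v]opprB euclid_normN ler_norml; lra.
Qed.

(** Rescale [v] radially; at [v = 0] any direction does, and [0 < m] provides one. *)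
Lemma exists_on_sphere v (a : R) : (0 < m)%N -> 0 <= a ->
  exists2 w, euclid_norm w = a & euclid_norm (v - w) = `|euclid_norm v - a|.
Proof.
move=> m0 a0; have [v0|vn0] := eqVneq (euclid_norm v) 0.
  exists (a *: delta_mx ord0 (Ordinal m0)).
    by rewrite euclid_normZ euclid_normE dotr_delta mxE !eqxx sqrtr1 mulr1
      ger0_norm.
  rewrite v0 (euclid_norm0_eq0 v0) !sub0r euclid_normN.
  by rewrite euclid_normZ euclid_normE dotr_delta mxE !eqxx sqrtr1 mulr1 normrN.
have vp : 0 < euclid_norm v by rewrite lt_neqAle eq_sym vn0 euclid_norm_ge0.
exists ((a / euclid_norm v) *: v).
  by rewrite euclid_normZ ger0_norm ?divfK// divr_ge0// ltW.
rewrite -{1}[v]scale1r -scalerBl euclid_normZ -[X in _ * X](gtr0_norm vp)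
  -normrM.
by congr `|_|; rewrite mulrBl mul1r divfK.
Qed.

(** Both halves of [y] have the same norm [k], so the squared distance is at least
    [(s - k)^2 + (t - k)^2], which the parallelogram identity bounds below by [(s - t)^2 / 2]. *)
Lemma cone_dist_le x y : simons_cone y ->
  `|s_coord x - t_coord x| / Num.sqrt 2 <= euclid_norm (x - y).
Proof.
rewrite /simons_cone/= !s_coordE !t_coordE => E.
have s2 : 0 < Num.sqrt 2 :> R by rewrite sqrtr_gt0.
rewrite ler_pdivrMr//.
rewrite -(@ler_pXn2r _ 2)// ?nnegrE ?mulr_ge0 ?euclid_norm_ge0 ?(ltW s2)//.
rewrite exprMn sqr_euclid_norm dotr_split sqr_sqrtr// -!sqr_euclid_norm.
have := euclid_norm_sub_ge (lsubmx x) (lsubmx y).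
have := euclid_norm_sub_ge (rsubmx x) (rsubmx y).
rewrite -E -!linearB/= real_normK ?num_real//.
set a := euclid_norm (lsubmx x); set b := euclid_norm (rsubmx x).
set k := euclid_norm (lsubmx y).
set A := euclid_norm _; set B := euclid_norm _ => H1 H2.
have : (b - k) ^+ 2 <= A ^+ 2.
  by rewrite -real_normK ?num_real// ler_pXn2r// nnegrE// euclid_norm_ge0.
have : (a - k) ^+ 2 <= B ^+ 2.
  by rewrite -real_normK ?num_real// ler_pXn2r// nnegrE// euclid_norm_ge0.
have := sqr_ge0 ((a - k) + (b - k)); lra.
Qed.

(** The common radius minimising [(s - k)^2 + (t - k)^2] is [(s + t) / 2]; each half of [x] is moved
    radially to it. *)
Lemma cone_nearest_point x : (0 < m)%N -> exists2 y, simons_cone y &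
  euclid_norm (x - y) = `|s_coord x - t_coord x| / Num.sqrt 2.
Proof.
move=> m0; set s := s_coord x; set t := t_coord x.
have s0 : 0 <= s by rewrite sqrtr_ge0.
have t0 : 0 <= t by rewrite sqrtr_ge0.
have a0 : 0 <= (s + t) / 2 by rewrite divr_ge0// addr_ge0.
have [w1 w1a w1E] := exists_on_sphere (lsubmx x) m0 a0.
have [w2 w2a w2E] := exists_on_sphere (rsubmx x) m0 a0.
exists (row_mx w1 w2).
  by rewrite /simons_cone/= s_coordE t_coordE row_mxKl row_mxKr w1a w2a.
have s2 : 0 < Num.sqrt 2 :> R by rewrite sqrtr_gt0.
apply/eqP; rewrite -(@eqrXn2 _ 2)// ?euclid_norm_ge0 ?divr_ge0 ?(ltW s2)//.
rewrite sqr_euclid_norm dotr_split -!sqr_euclid_norm !linearB/= row_mxKl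
  row_mxKr w1E w2E.
rewrite expr_div_n sqr_sqrtr// !real_normK ?num_real//
  -s_coordE -t_coordE -/s -/t.
by apply/eqP; field.
Qed.

Lemma euclid_dist_cone x : (0 < m)%N ->
  euclid_dist x simons_cone = `|s_coord x - t_coord x| / Num.sqrt 2.
Proof.
move=> m0; have [y Cy yE] := cone_nearest_point x m0.
apply/eqP; rewrite eq_le; apply/andP; split.
  rewrite -yE; apply: ge_inf; last by exists y.
  by exists 0 => _ [z _ <-]; exact: euclid_norm_ge0.
apply: lb_le_inf; first by exists (euclid_norm (x - y)), y.
by move=> _ [z Cz <-]; exact: cone_dist_le.
Qed.

End cone_distance.

(** The constants [L] and [B] depend on [c] and on the bound of [u], but do not enter the conclusion
    of [two_point_bound], so [c] is free to tend to 0 in [le_profile]. Oddness of the travel time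
    turns the estimate for [- h (u x)] into one for [- u x]. *)
Lemma abs_solution_le (R : realType) (f : R -> R) (M : R) (u0 u1 : R ->
  R) (m : nat)
    (u : 'rV[R]_(m + m) -> R) :
  continuous f -> (forall y : R, f (- y) = - f y) ->
  (forall y : R, 0 <= potential f M y) -> potential f M M = 0 -> 0 < M ->
  profile f M u0 u1 -> (0 < m)%N -> bounded_solution f u ->
  (forall x, simons_cone x -> u x = 0) ->
  forall x, `|u x| <= u0 (euclid_dist x simons_cone).
Proof.
move=> cf f_odd G_ge0 G_M M_gt0 pu0 m0 [Cu [K uK] solu] uC x.
have [y Cy yE] := cone_nearest_point x m0.
rewrite euclid_dist_cone//; set d := _ / _ in yE *.
have d0 : 0 <= d by rewrite -yE euclid_norm_ge0.
have K0 : 0 <= K := le_trans (normr_ge0 _) (uK x).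
have key c : 0 < c -> `|travel_time f M c (u x)| <= d.
  move=> c0.
  have dh := is_derive_travel_time cf G_ge0 c0.
  have dp := is_derive_slowness cf G_ge0 c0.
  have [L HL] := continuous_bounded_on_segment (is_derive_continuous dh) K0.
  have cfp : continuous (fun z => f z * slowness f M c z).
    by move=> z; apply: continuousM; [exact: cf|exact: (is_derive_continuous
      dp)].
  have [B HB] := continuous_bounded_on_segment cfp K0.
  have H := two_point_bound Cu solu dh dp (fun z => HL _ (uK z)) (fun z =>
    HB _ (uK z)).
  have := H x y; have := H y x; rewrite (uC y Cy) travel_time0//.
  rewrite -[y - x]opprB euclid_normN yE ler_norml; lra.
have pos := le_profile cf G_ge0 G_M M_gt0 d0 pu0.
rewrite ler_norml lerNl; apply/andP; split; apply: pos => c c0;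
  have := key c c0.
  by rewrite travel_time_odd// ler_norml lerNl => /andP[].
by rewrite ler_norml => /andP[].
Qed.

(** * Integration on tuples *)

Section lebesgue_tuple_facts.
Variable R : realType.
Local Notation mu := (lebesgue_tuple R).
Local Notation tuples n := (n.-tuple (measurableTypeR R)).

Definition box_tuple n (A : 'I_n -> set R) : set (tuples n) :=
  [set p | forall i, A i (tnth p i)].

Lemma measurable_box_tuple n (A : 'I_n -> set R) :
  (forall i, measurable (A i : set (measurableTypeR R))) ->
    measurable (box_tuple A).
Proof.
move=> mA; have -> : box_tuple A = \bigcap_(i in [set: 'I_n])
    (fun p : tuples n => tnth p i) @^-1` A i.
  by apply/seteqP; split=> p Ap i; [move=> _; exact: Ap|exact: Ap].
apply: fin_bigcap_measurable => [|i _]; first exact: finite_finset.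
by rewrite -[X in measurable X]setTI; exact: measurable_tnth.
Qed.

(** The sigma-algebra on tuples is known through boxes, so an open set is written as the countable
    union of the cubes with rational centre and radius [1 / (k + 1)] that it contains. *)
Lemma open_measurable_row n (U : set 'rV[R]_n) :
  open U -> measurable (@row_of_tuple R n @^-1` U).
Proof.
move=> oU.
pose b (q : 'rV[rat]_n * nat) : set 'rV[R]_n :=
  [set x | forall i, `|ratr (q.1 ord0 i) - x ord0 i| < q.2.+1%:R^-1].
pose F q := if pselect (b q `<=` U) then @row_of_tuple R n @^-1` b q else set0.
have -> : @row_of_tuple R n @^-1` U = \bigcup_q F q.
  apply/seteqP; split=> [p Up|p [q _]]; last by rewrite /F;
    case: pselect => // bU /bU.
  have /nbhs_ballP[r /= r0 rU] : nbhs (row_of_tuple p) U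
    by exact: open_nbhs_nbhs.
  (* Half of [r], because two points of a cube may be two radii apart. *)
  have [k kr] : exists k : nat, k.+1%:R^-1 < r / 2.
    exists (Num.truncn (r / 2)^-1); rewrite invf_plt ?posrE ?divr_gt0//.
    exact: truncnS_gt.
  have [q qp] : exists q : 'rV[rat]_n,
      forall i, `|ratr (q ord0 i) - row_of_tuple p ord0 i| < k.+1%:R^-1.
    have H i : exists c : rat, `|ratr c - row_of_tuple p ord0 i| < k.+1%:R^-1.
      have [|c] := @rat_in_itvoo R (row_of_tuple p ord0 i) (row_of_tuple p
        ord0 i + k.+1%:R^-1).
        by rewrite ltrDl.
      rewrite in_itv/= => /andP[c1 c2]; exists c.
      by rewrite ger0_norm ?subr_ge0 ?(ltW c1)// ltrBlDl.
    have [c Hc] := choice H.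
    by exists (\row_i c i) => i; rewrite mxE.
  exists (q, k) => //; rewrite /F; case: pselect => //= -[].
  move=> x xq; apply: rU; rewrite -ball_normE /ball_/=.
  apply: (@le_lt_trans _ _ (2 * k.+1%:R^-1)); last by move: kr;
    rewrite ltr_pdivlMr// mulrC.
  rewrite [leLHS]/Num.norm/= mx_normrE; apply/bigmax_leP; split;
    first by rewrite mulr_ge0.
  move=> [i j] _ /=; rewrite (ord1 i).
  have -> : (row_of_tuple p - x) ord0 j = row_of_tuple p ord0 j - x ord0 j
    by rewrite !mxE.
  have := ltW (qp j); have := ltW (xq j) => /=.
  move: (ratr (q ord0 j)) (k.+1%:R^-1) => c e.
  by rewrite !ler_norml => /andP[? ?] /andP[? ?]; apply/andP; split; lra.
apply: (@countable_bigcupT_measurable _ _ ('rV[rat]_n * nat)%type).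
  exact: countableP.
move=> q; rewrite /F; case: pselect => [bU|nbU] /=; last exact: measurable0.
have -> : @row_of_tuple R n @^-1` b q = box_tuple (fun i =>
  ball (ratr (q.1 ord0 i) : R) q.2.+1%:R^-1).
  by apply/seteqP; split=> p H i; have := H i; rewrite mxE.
by apply: measurable_box_tuple => i; exact: measurable_ball.
Qed.

Lemma continuous_measurable_row n (g : 'rV[R]_n -> R) :
  continuous g -> measurable_fun setT (g \o @row_of_tuple R n).
Proof.
move=> /continuousP cg; apply: (measurability _ (RGenOpens.measurableE R)) =>
  //.
move=> _ [_ [a [b ->] <-]]; rewrite setTI comp_preimage.
by apply: open_measurable_row; exact/cg/interval_open.
Qed.

Definition cube_tuple n (B : R) : set (tuples n) := box_tuple (fun=>
  `[- B, B]%classic).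
Arguments cube_tuple : clear implicits.

Lemma measurable_cube_tuple n B : measurable (cube_tuple n B).
Proof. by apply: measurable_box_tuple => i; exact: measurable_itv. Qed.

Lemma cube_tuple_ltoo n B : (mu n (cube_tuple n B) < +oo)%E.
Proof.
rewrite lebesgue_tuple_box; last by move=> i; exact: measurable_itv.
rewrite ltey_eq prode_fin_num// => i _.
by rewrite lebesgue_measure_itv/=; case: ifP.
Qed.

Lemma sigma_finite_lebesgue_tuple n : sigma_finite setT (mu n).
Proof.
exists (fun k => cube_tuple n k%:R); last first.
  by move=> k; split; [exact: measurable_cube_tuple|exact: cube_tuple_ltoo].
apply/seteqP; split=> // p _.
exists (Num.truncn `|row_of_tuple p|).+1 => // i.
rewrite /= in_itv/= -ler_norml; apply: le_trans (ltW (truncnS_gt _)).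
by apply: le_trans (coord_le_norm (row_of_tuple p) i); rewrite mxE.
Qed.

(* An alias on which the sigma-finite structure can be declared. *)
Definition sigma_finite_lebesgue n : set (tuples n) -> \bar R := mu n.
Arguments sigma_finite_lebesgue : clear implicits.
HB.instance Definition _ n := Measure.copy (sigma_finite_lebesgue n) (mu n).
HB.instance Definition _ n := Measure_isSigmaFinite.Build _ _ _
  (sigma_finite_lebesgue n) (sigma_finite_lebesgue_tuple n).

Lemma integrable_bounded_support d (T : measurableType d) (m : {measure set T
  -> \bar R})
    (D : set T) (g : T -> R) (C : R) :
  measurable D -> (m D < +oo)%E -> measurable_fun setT g ->
  (forall x, `|g x| <= C) -> (forall x, ~ D x -> g x = 0) ->
  m.-integrable setT (EFin \o g).
Proof.
move=> mD Doo mg gC gD.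
have -> : EFin \o g = (EFin \o g) \_ D.
  apply/funext => x; rewrite patchE; case: ifPn => // /negP xD.
  by rewrite /= gD// => Dx; apply: xD; exact: mem_set.
apply/integrable_restrict => //; rewrite setTI.
apply: measurable_bounded_integrable => //; first exact: measurable_funS mg.
by exists C; split; [exact: num_real|move=> M CM x _;
  apply: le_trans (gC x) (ltW CM)].
Qed.

(** Both orders are wanted: a derivative in the first coordinate is integrated with that coordinate
    innermost, any other derivative with it outermost, as a parameter. Boundedness and support in a
    cube give integrability for both product constructions involved. *)
Lemma iterated_integral_lebesgue_tuple n (g : tuples n.+1 -> R) (C B : R) :
  measurable_fun setT g -> (forall p, `|g p| <= C) ->
  (forall p, ~ cube_tuple n.+1 B p -> g p = 0) ->
  (\int[mu n.+1]_p (g p)%:E =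
     \int[lebesgue_measure]_a \int[mu n]_p (g (cons_pair (a, p)))%:E)%E /\
  (\int[mu n.+1]_p (g p)%:E =
     \int[mu n]_p \int[lebesgue_measure]_a (g (cons_pair (a, p)))%:E)%E.
Proof.
move=> mg gC gB; pose nu : {sigma_finite_measure set (tuples n) ->
  \bar R} := sigma_finite_lebesgue n.
have mcons := @measurable_cons_pair R n.
have ig : (mu n.+1).-integrable setT (EFin \o g).
  apply: (@integrable_bounded_support _ _ (mu n.+1) (cube_tuple n.+1 B) g C)
    => //.
    exact: measurable_cube_tuple.
  exact: cube_tuple_ltoo.
pose gc := g \o @cons_pair R n.
have mgc : measurable_fun setT gc by exact: measurableT_comp.
pose I : set (measurableTypeR R) := `[- B, B]%classic.
have mI : measurable I by exact: measurable_itv.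
have mC := @measurable_cube_tuple n B.
have Aoo : (@lebesgue_measure R I * nu (cube_tuple n B) < +oo)%E.
  rewrite lte_mul_pinfty//; last exact: cube_tuple_ltoo.
  by rewrite /I lebesgue_measure_itv/=; case: ifP.
have igc (m : {measure set (measurableTypeR R * tuples n) -> \bar R}) :
    (m (I `*` cube_tuple n B) < +oo)%E ->
    m.-integrable setT (EFin \o gc).
  move=> moo; apply: (integrable_bounded_support _ moo mgc (C := C)) => //.
  - exact: measurableX.
  - by move=> x; exact: gC.
  - move=> [a p] H; apply: gB => H'; apply: H; split.
      by have := H' ord0.
    by move=> i; have := H' (lift ord0 i); rewrite tnthS.
have igc1 : ((@lebesgue_measure R) \x nu)%E.-integrable setT (EFin \o gc).
  by apply: igc; apply: (eq_ind_r (fun z =>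
    (z < +oo)%E) _ (product_measure1E (@lebesgue_measure R) nu mI mC)).
have igc2 : ((@lebesgue_measure R) \x^ nu)%E.-integrable setT (EFin \o gc).
  by apply: igc; apply: (eq_ind_r (fun z =>
    (z < +oo)%E) _ (product_measure2E (@lebesgue_measure R) nu mI mC)).
have E : (\int[mu n.+1]_p (g p)%:E = \int[(@lebesgue_measure R) \x^ nu]_z (gc
  z)%:E)%E.
  have mEg : measurable_fun setT (EFin \o g) by exact/measurable_EFinP.
  exact: (@integral_pushforward _ _ _ _ _ _ mcons _ setT (EFin \o g) mEg igc2
    measurableT).
split; rewrite E.
  by rewrite -(integral12_prod_meas2 igc1).
by rewrite -(integral21_prod_meas2 igc1).
Qed.

End lebesgue_tuple_facts.
Arguments cube_tuple : clear implicits.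

(** * Splitting off the first coordinate of a row vector *)

Section cons_row.
Variables (R : realType) (n : nat).
Implicit Types (a : R) (y : 'rV[R]_n).

Definition cons_row a y : 'rV[R]_n.+1 :=
  \row_i (if unlift ord0 i is Some j then y ord0 j else a).

Lemma cons_row0 a y : cons_row a y ord0 ord0 = a.
Proof. by rewrite mxE unlift_none. Qed.

Lemma cons_row_lift a y j : cons_row a y ord0 (lift ord0 j) = y ord0 j.
Proof. by rewrite mxE liftK. Qed.

Lemma row_of_cons_pair a (p : n.-tuple (measurableTypeR R)) :
  row_of_tuple (cons_pair (a, p)) = cons_row a (row_of_tuple p).
Proof.
apply/rowP => i; rewrite mxE; case: (unliftP ord0 i) => [j|] ->.
  by rewrite cons_row_lift mxE tnthS.
by rewrite cons_row0.
Qed.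

Lemma cons_rowD_lift a y j h :
  cons_row a (h *: delta_mx ord0 j + y) = h *: delta_mx ord0 (lift ord0 j) +
    cons_row a y.
Proof.
apply/rowP => i; case: (unliftP ord0 i) => [k|] ->.
  by rewrite cons_row_lift !mxE liftK (inj_eq lift_inj).
by rewrite cons_row0 !mxE unlift_none andbF mulr0 add0r.
Qed.

Lemma cons_row_delta0 a y : cons_row a y = cons_row 0 y + a *: delta_mx ord0
  ord0.
Proof.
apply/rowP => i; case: (unliftP ord0 i) => [k|] ->.
  by rewrite cons_row_lift !mxE liftK andbF mulr0 addr0.
by rewrite cons_row0 !mxE unlift_none eqxx mulr1 add0r.
Qed.

Lemma continuous_cons_row a : continuous (cons_row a).
Proof.
move=> y; apply/(@cvgrPdist_lt R _ _ _ (nbhs_filter y)) => e e0;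
  apply/nbhs_ballP; exists e => //= z; rewrite -ball_normE /ball_/=.
apply: le_lt_trans.
rewrite [leLHS]/Num.norm/= mx_normrE; apply/bigmax_leP; split => //.
move=> [i j] _ /=; rewrite (ord1 i) mxE [(- cons_row a z) _ _]mxE.
case: (unliftP ord0 j) => [k|] ->.
  by rewrite !cons_row_lift; apply: le_trans (coord_le_norm _ k); rewrite !mxE.
by rewrite !cons_row0 subrr normr0.
Qed.

Variable g : 'rV[R]_n.+1 -> R.

Lemma growth_cons_row a y j :
  (fun h : R => h^-1 *: (((fun z => g (cons_row a z)) \o shift y) (h *:
    delta_mx ord0 j) - g (cons_row a y)))
  = (fun h : R => h^-1 *: ((g \o shift (cons_row a y)) (h *: delta_mx ord0
    (lift ord0 j)) - g (cons_row a y))).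
Proof. by apply/funext => h /=; rewrite cons_rowD_lift. Qed.

Lemma partial_cons_row a y j :
  partial j (fun z => g (cons_row a z)) y = partial (lift ord0 j) g (cons_row
    a y).
Proof. by rewrite /partial /derive growth_cons_row. Qed.

Lemma derivable_cons_row a y j :
  derivable g (cons_row a y) (delta_mx ord0 (lift ord0 j)) ->
  derivable (fun z => g (cons_row a z)) y (delta_mx ord0 j).
Proof. by rewrite /derivable growth_cons_row. Qed.

End cons_row.

(** * Integrals of partial derivatives *)

Section integral_partial.
Variable R : realType.
Local Notation mu := (lebesgue_tuple R).

Lemma integral_derivative_eq0 (g g' : R -> R) (B : R) :
  (forall x : R, is_derive x 1 g (g' x)) -> continuous g' -> 0 <= B ->
  (forall x, B < `|x| -> g x = 0) -> (forall x, B < `|x| -> g' x = 0) ->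
  (\int[lebesgue_measure]_x (g' x)%:E = 0)%E.
Proof.
move=> dg cg' B0 gB g'B.
(* The vanishing of [g] is only known strictly beyond [B], hence the endpoints at distance
   [B + 1]. *)
have -> : (\int[lebesgue_measure]_x (g' x)%:E = \int[lebesgue_measure]_(x in
  `[(- (B + 1))%R, (B + 1)%R]) (g' x)%:E)%E.
  rewrite [RHS]integral_mkcond; apply: eq_integral => x _; rewrite patchE.
  case: ifPn => // /negP xB; rewrite g'B//.
  rewrite ltNge; apply/negP => xB'; apply: xB; apply: mem_set.
  by rewrite /= in_itv/= -ler_norml (le_trans xB')// lerDl.
have cg : continuous g := is_derive_continuous dg.
have B1 : B < B + 1 by rewrite ltrDl.
rewrite (@continuous_FTC2 _ _ g).
- have B1' : 0 <= B + 1 by rewrite addr_ge0.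
  rewrite (gB (B + 1)) ?(gB (- (B + 1))) ?subee//; last by rewrite ger0_norm.
  by rewrite normrN ger0_norm.
- lra.
- exact: continuous_subspaceT.
- split=> [x _||]; first by have [] := dg x.
    exact/cvg_at_right_filter/cg.
  exact/cvg_at_left_filter/cg.
- by move=> x _; rewrite derive1E; have [] := dg x.
Qed.

(** Induction on the dimension: the first coordinate is handled by the fundamental theorem on each
    line, any other one by freezing the first coordinate and using the induction hypothesis on the
    slice. *)
Lemma integral_partial_eq0 n (i : 'I_n) (g : 'rV[R]_n -> R) (B : R) :
  continuous g -> (forall x, derivable g x (delta_mx ord0 i)) ->
  continuous (partial i g) -> 0 <= B ->
  (forall x, B < `|x| -> g x = 0) -> (forall x, B < `|x| ->
    partial i g x = 0) ->
  (\int[mu n]_p (partial i g (row_of_tuple p))%:E = 0)%E.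
Proof.
move=> + + + B0.
elim: n i g => [[]//|n IHn] i g cg dg cpg gB pgB.
have [C C0 HC'] := continuous_bounded_on_ball cpg B0.
have HC x : `|partial i g x| <= C.
  by have [/HC'//|/pgB ->] := leP `|x| B; rewrite normr0.
have out (p : n.+1.-tuple (measurableTypeR R)) : ~ cube_tuple R n.+1 B p ->
  partial i g (row_of_tuple p) = 0.
  move=> pB; apply: pgB; rewrite ltNge; apply/negP => pB'; apply: pB => j.
  rewrite /= in_itv/= -ler_norml; apply: le_trans pB'.
  by apply: le_trans (coord_le_norm (row_of_tuple p) j); rewrite mxE.
have mpg := continuous_measurable_row cpg.
have [E1 E2] := iterated_integral_lebesgue_tuple mpg (fun p =>
  HC (row_of_tuple p)) out.
have norm0 a (y : 'rV[R]_n) : `|a| <= `|cons_row a y|.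
  by rewrite -{1}(cons_row0 a y) coord_le_norm.
have normy a (y : 'rV[R]_n) : `|y| <= `|cons_row a y|.
  rewrite [leLHS]/Num.norm/= mx_normrE; apply/bigmax_leP; split => //.
  move=> [k j] _ /=; rewrite (ord1 k) -(cons_row_lift a y j).
  exact: coord_le_norm.
case: (unliftP ord0 i) => [j|] iE.
  rewrite iE in dg cpg E1 pgB *; rewrite E1; apply: integral0_eq => a _.
  under eq_integral do rewrite /= row_of_cons_pair -partial_cons_row.
  apply: IHn => [x|x|x|x xB|x xB].
  - by apply: continuous_comp; [exact: continuous_cons_row|exact: cg].
  - by apply: derivable_cons_row; exact: dg.
  - rewrite (_ : partial _ _ = partial (lift ord0 j) g \o cons_row a);
    last first.
      by apply/funext => y; rewrite partial_cons_row.
    by apply: continuous_comp; [exact: continuous_cons_row|exact: cpg].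
  - by apply: gB; apply: lt_le_trans xB (normy a x).
  - by rewrite partial_cons_row; apply: pgB; apply: lt_le_trans xB (normy a x).
rewrite iE in dg cpg E2 pgB *; rewrite E2; apply: integral0_eq => p _.
under eq_integral do rewrite /= row_of_cons_pair cons_row_delta0.
apply: (@integral_derivative_eq0 (fun a =>
  g (cons_row 0 (row_of_tuple p) + a *: delta_mx ord0 ord0)) _ B).
- by move=> a; apply: is_derive_line; exact: derivableP.
- move=> a; apply: (@continuous_comp _ _ _ (fun a : R =>
  cons_row 0 (row_of_tuple p) + a *: delta_mx ord0 ord0) (partial ord0 g)).
    by apply: cvgD; [exact: cvg_cst|apply: cvgZr_tmp; exact: cvg_id].
  exact: cpg.
- exact: B0.
- by move=> a aB; apply: gB; rewrite -cons_row_delta0;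
  apply: lt_le_trans aB (norm0 _ _).
- by move=> a aB; apply: pgB; rewrite -cons_row_delta0;
  apply: lt_le_trans aB (norm0 _ _).
Qed.

End integral_partial.

(** * The regularised field *)

Lemma is_derive_coord (R : realType) n (x v : 'rV[R]_n) j :
  is_derive x v (fun y : 'rV[R]_n => y ord0 j) (v ord0 j).
Proof.
apply: is_derive_of_line.
have -> : (fun t : R => (x + t *: v) ord0 j) = (fun t =>
  x ord0 j + t * v ord0 j).
  by apply/funext => t; rewrite !mxE.
by apply: is_derive_eqE; rewrite /GRing.scale/=; ring.
Qed.

(* With [e = 0] this is the norm of the block [i_], and [reg_dir] vanishes at
   its zeros because [0 / 0 = 0]. *)
Section regularised_norm.
Variables (R : realType) (m n : nat) (i_ : 'I_m -> 'I_n) (e : R).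
Implicit Types x v : 'rV[R]_n.

Definition block_sqnorm x : R := \sum_(i < m) x ord0 (i_ i) ^+ 2.

Definition reg_norm x : R := Num.sqrt (block_sqnorm x + e).

Definition reg_dir i x : R := x ord0 (i_ i) / reg_norm x.

Lemma block_sqnorm_ge0 x : 0 <= block_sqnorm x.
Proof. by apply: sumr_ge0 => i _; rewrite sqr_ge0. Qed.

Lemma is_derive_block_sqnorm x v :
  is_derive x v block_sqnorm (2 * \sum_(i < m) x ord0 (i_ i) * v ord0 (i_ i)).
Proof.
rewrite mulr_sumr; apply: is_derive_sumE => i.
apply: is_derive_eqE (is_derive_sqrE (is_derive_coord x v (i_ i))).
by rewrite mulrA.
Qed.

Lemma is_derive_reg_norm x v : 0 < block_sqnorm x + e ->
  is_derive x v reg_norm ((\sum_(i < m) x ord0 (i_ i) * v ord0 (i_ i)) /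
    reg_norm x).
Proof.
move=> x0.
have s0 : reg_norm x != 0 by rewrite gt_eqF// sqrtr_gt0.
have dq := is_derive_addE (is_derive_block_sqnorm x v) (is_derive_cstE e x v).
have := @is_derive_compE _ _ Num.sqrt (fun y =>
  block_sqnorm y + e) x v _ _ (is_derive1_sqrt x0) dq.
by apply: is_derive_eqE; rewrite -/(reg_norm x); field.
Qed.

Hypothesis i_inj : injective i_.

Lemma sum_coord_delta x i :
  \sum_(j < m) x ord0 (i_ j) * (delta_mx ord0 (i_ i) : 'rV[R]_n) ord0 (i_ j) =
    x ord0 (i_ i).
Proof.
rewrite (bigD1 i)//= mxE !eqxx mulr1 big1 ?addr0// => j ji.
by rewrite mxE (inj_eq i_inj) (negPf ji) andbF mulr0.
Qed.

Lemma is_derive_reg_norm_in x i : 0 < block_sqnorm x + e ->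
  is_derive x (delta_mx ord0 (i_ i)) reg_norm (reg_dir i x).
Proof.
by move=> x0; apply: is_derive_eqE (is_derive_reg_norm _ x0);
  rewrite sum_coord_delta.
Qed.

(* Also at the zeros of [reg_norm], which is constant in these directions. *)
Lemma is_derive_reg_norm_out x k : (forall i, i_ i != k) ->
  is_derive x (delta_mx ord0 k) reg_norm 0.
Proof.
move=> ik; apply: is_derive_of_line.
have -> : (fun t : R => reg_norm (x + t *: delta_mx ord0 k)) = fun=> reg_norm x.
  apply/funext => t; rewrite /reg_norm /block_sqnorm; congr (Num.sqrt (_ + _)).
  by apply: eq_bigr => i _; rewrite !mxE (negPf (ik i)) andbF mulr0 addr0.
exact: is_derive_cstE.
Qed.

Lemma reg_dir_le1 i x : 0 <= e -> `|reg_dir i x| <= 1.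
Proof.
move=> e0; have q0 := block_sqnorm_ge0 x.
have [n0|n0] := eqVneq (reg_norm x) 0;
  first by rewrite /reg_dir n0 invr0 mulr0 normr0.
have np : 0 < reg_norm x by rewrite lt_neqAle eq_sym n0 sqrtr_ge0.
rewrite normrM normfV (gtr0_norm np) ler_pdivrMr// mul1r -sqrtr_sqr.
apply: ler_wsqrtr; rewrite /block_sqnorm (bigD1 i)//= -addrA lerDl addr_ge0//.
by apply: sumr_ge0 => j _; rewrite sqr_ge0.
Qed.

Lemma continuous_block_sqnorm : continuous block_sqnorm.
Proof. by apply: continuous_sumE => i;
  exact/continuous_sqrE/continuous_coord. Qed.

Lemma continuous_reg_norm : continuous reg_norm.
Proof.
apply: continuous_compE; first exact: sqrt_continuous.
apply: continuous_addE; [exact: continuous_block_sqnorm|exact: continuous_cstE].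
Qed.

Hypothesis e0 : 0 < e.

Lemma reg_gt0 x : 0 < block_sqnorm x + e.
Proof. by rewrite ltr_wpDl// block_sqnorm_ge0. Qed.

Lemma reg_norm_gt0 x : 0 < reg_norm x.
Proof. by rewrite sqrtr_gt0 reg_gt0. Qed.

Lemma sqr_reg_norm x : reg_norm x ^+ 2 = block_sqnorm x + e.
Proof. by rewrite sqr_sqrtr// ltW// reg_gt0. Qed.

(** The derivative of [reg_dir i] in its own direction, so that the sum over [i] is the Laplacian of
    [reg_norm]. *)
Definition reg_curv i x : R := (reg_norm x)^-1 - x ord0 (i_ i) ^+ 2 / reg_norm
  x ^+ 3.

Lemma is_derive_inv (V : normedModType R) (g : V -> R) (x v : V) (a : R) :
  g x != 0 -> is_derive x v g a -> is_derive x v (fun y =>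
    (g y)^-1) (- a / g x ^+ 2).
Proof.
move=> g0 dg; apply: is_derive_of_line.
have g0' : g (x + 0 *: v) != 0 by rewrite scale0r addr0.
have dg' : is_derive (0 : R) 1 (fun t : R => g (x + t *: v)) a.
  by apply: is_derive_line; rewrite scale0r addr0.
have := @is_deriveV R (fun t : R => g (x + t *: v)) 0 a 1 g0' dg'.
by apply: is_derive_eqE; rewrite scale0r addr0 /GRing.scale/= mulrC mulrN mulNr.
Qed.

Lemma is_derive_reg_dir i x :
  is_derive x (delta_mx ord0 (i_ i)) (reg_dir i) (reg_curv i x).
Proof.
have n0 : reg_norm x != 0 by rewrite gt_eqF// reg_norm_gt0.
apply: is_derive_eqE (is_derive_mulE (is_derive_coord x _ (i_ i))
  (is_derive_inv n0 (is_derive_reg_norm_in i (reg_gt0 x)))).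
by rewrite /reg_curv /reg_dir mxE !eqxx /=; field.
Qed.

Lemma continuous_reg_norm_inv : continuous (fun x => (reg_norm x)^-1).
Proof.
apply: continuous_invE; last exact: continuous_reg_norm.
by move=> x; rewrite gt_eqF// reg_norm_gt0.
Qed.

Lemma continuous_reg_dir i : continuous (reg_dir i).
Proof.
apply: continuous_mulE; last exact: continuous_reg_norm_inv.
exact: continuous_coord.
Qed.

Lemma continuous_reg_curv i : continuous (reg_curv i).
Proof.
rewrite (_ : reg_curv i = fun x => (reg_norm x)^-1 - reg_dir i x ^+ 2 *
  (reg_norm x)^-1).
  apply: continuous_addE; first exact: continuous_reg_norm_inv.
  apply: continuous_oppE; apply: continuous_mulE;
    last exact: continuous_reg_norm_inv.
  exact/continuous_sqrE/continuous_reg_dir.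
apply/funext => x; rewrite /reg_curv /reg_dir.
by field; rewrite gt_eqF// reg_norm_gt0.
Qed.

Lemma sum_reg_curv x :
  \sum_(i < m) reg_curv i x = (m%:R - 1) / reg_norm x + e / reg_norm x ^+ 3.
Proof.
rewrite sumrB sumr_const card_ord -mulr_suml -/(block_sqnorm x).
have -> : block_sqnorm x = reg_norm x ^+ 2 - e by rewrite sqr_reg_norm addrK.
by rewrite -mulr_natr; field; rewrite gt_eqF// reg_norm_gt0.
Qed.

End regularised_norm.

(** * The gradient of the regularised function and its divergence *)

Section regularised_field.
Variables (R : realType) (f : R -> R) (M : R) (u0 u1 : R ->
  R) (m : nat) (e : R).
Hypotheses (cf : continuous f) (pu0 : profile f M u0 u1) (m_gt0 : (0 < m)%N).
Local Notation L := (@lshift m m).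
Local Notation T := (@rshift m m).
Implicit Types x : 'rV[R]_(m + m).
Let c : R := (Num.sqrt 2)^-1.

Definition reg_height x : R := (reg_norm L e x - reg_norm T e x) / Num.sqrt 2.

(** The gradient of [u0 (reg_height e x)] for [e > 0]. Given by a formula, it also makes sense for
    [e = 0], where it is the pointwise limit everywhere, including at the kinks. *)
Definition reg_field (k : 'I_(m + m)) x : R :=
  match fintype.split k with
  | inl i => c * u1 (reg_height x) * reg_dir L e i x
  | inr i => - (c * u1 (reg_height x) * reg_dir T e i x)
  end.

Definition reg_field_deriv (k : 'I_(m + m)) x : R :=
  match fintype.split k with
  | inl i => c * u1 (reg_height x) * reg_curv L e i x
    - f (u0 (reg_height x)) * reg_dir L e i x ^+ 2 / 2
  | inr i => - (c * u1 (reg_height x) * reg_curv T e i x)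
    - f (u0 (reg_height x)) * reg_dir T e i x ^+ 2 / 2
  end.

(** The squared length of the gradient of [reg_height]; it multiplies [u0'' = - f (u0)] in the
    Laplacian of [u0 (reg_height)], and equals 1 when [e = 0] and neither [s] nor [t] vanishes. *)
Definition reg_weight x : R :=
  (\sum_(i < m) reg_dir L e i x ^+ 2 + \sum_(i < m) reg_dir T e i x ^+ 2) / 2.

Lemma lshift_neq_rshift i j : L i != T j.
Proof. by rewrite eq_lrshift. Qed.

Lemma rshift_neq_lshift i j : T i != L j.
Proof. by rewrite eq_rlshift. Qed.

Lemma is_derive_reg_height_L x i : 0 < block_sqnorm L x + e ->
  is_derive x (delta_mx ord0 (L i)) reg_height (c * reg_dir L e i x).
Proof.
move=> x0.
have dn := is_derive_subE (is_derive_reg_norm_in (@lshift_inj _ _) i x0)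
  (is_derive_reg_norm_out e x (fun j => rshift_neq_lshift j i)).
apply: is_derive_eqE (is_derive_mulE dn (is_derive_cstE (Num.sqrt 2)^-1 _ _)).
by rewrite -/c; ring.
Qed.

Lemma is_derive_reg_height_T x i : 0 < block_sqnorm T x + e ->
  is_derive x (delta_mx ord0 (T i)) reg_height (- (c * reg_dir T e i x)).
Proof.
move=> x0.
have dn := is_derive_subE (is_derive_reg_norm_out e x (fun j =>
  lshift_neq_rshift j i))
  (is_derive_reg_norm_in (@rshift_inj _ _) i x0).
apply: is_derive_eqE (is_derive_mulE dn (is_derive_cstE (Num.sqrt 2)^-1 _ _)).
by rewrite -/c; ring.
Qed.

Lemma continuous_reg_height : continuous reg_height.
Proof.
apply: continuous_mulE; last exact: continuous_cstE.
by apply: continuous_addE; [|apply: continuous_oppE];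
  exact: continuous_reg_norm.
Qed.

Lemma reg_field_le C : 0 <= e -> (forall y, u1 y <= C) ->
  forall k x, `|reg_field k x| <= C.
Proof.
move=> e0 uC k x; have [_ _ _ u1_gt0 _] := pu0.
have c0 : 0 <= c by rewrite invr_ge0 sqrtr_ge0.
have c1 : c <= 1.
  rewrite invf_le1 ?sqrtr_gt0// -[leLHS]sqrtr1; apply: ler_wsqrtr; lra.
have H b : `|b| <= 1 -> `|c * u1 (reg_height x) * b| <= C.
  move=> b1; have u10 := ltW (u1_gt0 (reg_height x)).
  rewrite !normrM (ger0_norm c0) (ger0_norm u10);
    apply: le_trans (uC (reg_height x)).
  have cu : c * u1 (reg_height x) <= u1 (reg_height x) by rewrite ler_piMl.
  by apply: le_trans cu; rewrite ler_piMr// mulr_ge0.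
by rewrite /reg_field; case: (fintype.split k) => i; rewrite ?normrN;
  apply: H; exact: reg_dir_le1.
Qed.

Hypothesis e0 : 0 < e.

Let cc : c * c = 2^-1.
Proof. by rewrite -invfM -expr2 sqr_sqrtr. Qed.

Lemma is_derive_reg_field k x :
  is_derive x (delta_mx ord0 k) (reg_field k) (reg_field_deriv k x).
Proof.
have [_ du1 _ _ _] := pu0.
rewrite /reg_field /reg_field_deriv -{1}(splitK k);
  case: (fintype.split k) => i /=.
  have dz := is_derive_compE (du1 _) (is_derive_reg_height_L i (reg_gt0 L e0
    x)).
  apply: is_derive_eqE (is_derive_mulE (is_derive_scaleE c dz)
    (is_derive_reg_dir (@lshift_inj _ _) e0 i x)).
  by rewrite -cc; ring.
have dz := is_derive_compE (du1 _) (is_derive_reg_height_T i (reg_gt0 T e0 x)).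
apply: is_derive_eqE (is_derive_oppE (is_derive_mulE (is_derive_scaleE c dz)
  (is_derive_reg_dir (@rshift_inj _ _) e0 i x))).
by rewrite -cc; ring.
Qed.

Let continuous_u1z : continuous (fun x => c * u1 (reg_height x)).
Proof.
have [_ du1 _ _ _] := pu0.
apply: continuous_mulE; first exact: continuous_cstE.
apply: continuous_compE; first exact: (is_derive_continuous du1).
exact: continuous_reg_height.
Qed.

Lemma continuous_reg_field k : continuous (reg_field k).
Proof.
rewrite /reg_field; case: (fintype.split k) => i; [|apply: continuous_oppE];
  by apply: continuous_mulE; [exact: continuous_u1z|exact: continuous_reg_dir].
Qed.

Lemma continuous_f_height : continuous (fun x => f (u0 (reg_height x))).
Proof.
have [du0 _ _ _ _] := pu0.
apply: continuous_compE => //.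
apply: continuous_compE; first exact: (is_derive_continuous du0).
exact: continuous_reg_height.
Qed.

Lemma continuous_reg_field_deriv k : continuous (reg_field_deriv k).
Proof.
have cq i_ i : continuous (fun x => f (u0 (reg_height x)) * reg_dir i_ e i x
  ^+ 2 / 2).
  apply: continuous_mulE; last exact: continuous_cstE.
  by apply: continuous_mulE; [exact:
    continuous_f_height|exact/continuous_sqrE/continuous_reg_dir].
rewrite /reg_field_deriv; case: (fintype.split k) => i;
  (apply: continuous_addE; [|exact/continuous_oppE/cq]).
- by apply: continuous_mulE; [exact: continuous_u1z|exact: continuous_reg_curv].
- by apply: continuous_oppE; apply: continuous_mulE;
  [exact: continuous_u1z|exact: continuous_reg_curv].
Qed.

Lemma split_lshift i : fintype.split (L i) = inl i.
Proof. exact: (unsplitK (inl i)). Qed.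

Lemma split_rshift i : fintype.split (T i) = inr i.
Proof. exact: (unsplitK (inr i)). Qed.

(* The curvature sum (m - 1) / N + e / N^3 is decreasing in N, which gives the
   sign on the side of the cone where the first regularised norm is larger. *)
Lemma sum_reg_field_deriv_le x : t_coord x < s_coord x ->
  \sum_k reg_field_deriv k x <= - (f (u0 (reg_height x)) * reg_weight x).
Proof.
move=> ts; have [_ _ _ u1_gt0 _] := pu0.
rewrite big_split_ord /= /reg_field_deriv.
under eq_bigr do rewrite split_lshift.
under [X in _ + X]eq_bigr do rewrite split_rshift.
rewrite !sumrB sumrN -!mulr_sumr -!mulr_suml -!mulr_sumr !sum_reg_curv//.
set F := f _; set U := u1 _; set A := \sum_(i < m) _; set B := \sum_(i < m) _.
have lt : reg_norm T e x < reg_norm L e x.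
  rewrite ltr_sqrt ?reg_gt0// ltrD2r.
  rewrite ltNge; apply/negP => H.
  have : s_coord x <= t_coord x := ler_wsqrtr H.
  by rewrite leNgt ts.
have T0 := reg_norm_gt0 T e0 x; have L0 := reg_norm_gt0 L e0 x.
move: lt T0 L0; set a := reg_norm T e x; set b := reg_norm L e x => ab a0 b0.
have m1 : 0 <= (m%:R - 1 : R) by rewrite subr_ge0 ler1n.
have H1 : (m%:R - 1) / b <= (m%:R - 1) / a by rewrite ler_wpM2l// lef_pV2// ltW.
have H2 : e / b ^+ 3 <= e / a ^+ 3.
  rewrite ler_pM2l// lef_pV2 ?posrE ?exprn_gt0//.
  by rewrite ler_pXn2r// ?nnegrE ltW.
have cU : 0 <= c * U by apply: mulr_ge0;
  [rewrite invr_ge0 sqrtr_ge0|exact/ltW/u1_gt0].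
have H3 : c * U * ((m%:R - 1) / b + e / b ^+ 3) <= c * U * ((m%:R - 1) / a + e
  / a ^+ 3).
  by rewrite ler_wpM2l// lerD.
rewrite /reg_weight -/A -/B.
have -> : F * ((A + B) / 2) = F * A / 2 + F * B / 2 by field.
lra.
Qed.

End regularised_field.

(** * Passage to the limit *)

(* [derive] is a [lim], whose junk value does not depend on the function; this
   makes the gradient of the profile measurable on [t = 0]. *)
Lemma derive_not_derivable (R : realType) : exists c : R,
  forall n (u : 'rV[R]_n -> R) x v, ~ derivable u x v -> 'D_v u x = c.
Proof. by eexists => n u x v; exact: dvgP. Qed.

(** The difference quotients at [h] and [- h] are opposite; a common limit would be 0, whereas one
    of them tends to [a]. *)
Lemma abs_kink_not_derivable (R : realType) n (u : 'rV[R]_n ->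
  R) x v (g : R -> R) (a : R) :
  (forall h : R, u (x + h *: v) = g `|h|) -> is_derive (0 : R) 1 g a ->
    a != 0 ->
  ~ derivable u x v.
Proof.
move=> ug [cg ga] a0 /cvg_ex[l ul].
have {}cg : (fun h => h^-1 *: ((g \o shift 0) (h *: 1) - g 0)) @ 0^' --> a
  by rewrite -ga; exact: cg.
(* A quarter suffices: closeness to [l] forces [|q| < |a| / 4], closeness to [a] forces
   [|q| > 3 |a| / 4]. *)
have e0 : 0 < `|a| / 4 by rewrite divr_gt0// normr_gt0.
move/cvgrPdist_lt : cg => /(_ _ e0)/nbhs_ballP[d1 /= d10 H1].
move/cvgrPdist_lt : ul => /(_ _ e0)/nbhs_ballP[d2 /= d20 H2].
pose h := Num.min d1 d2 / 2.
have m0 : 0 < Num.min d1 d2 by rewrite lt_min d10.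
have h0 : 0 < h by rewrite divr_gt0.
have hm : h < Num.min d1 d2 by rewrite /h ltr_pdivrMr// ltr_pMr// ltr1n.
have hd1 : h < d1 by apply: lt_le_trans hm _; rewrite ge_min lexx.
have hd2 : h < d2 by apply: lt_le_trans hm _; rewrite ge_min lexx orbT.
pose q := h^-1 * (g h - g 0).
have := H1 h; rewrite /ball/= sub0r normrN gtr0_norm// gt_eqF// => /(_ hd1 isT).
have := H2 h; rewrite /ball/= sub0r normrN gtr0_norm// gt_eqF// => /(_ hd2 isT).
have := H2 (- h); rewrite /ball/= sub0r opprK gtr0_norm// oppr_eq0 gt_eqF// =>
  /(_ hd2 isT).
have ux : u x = g 0 by rewrite -[x in LHS]addr0 -[X in x + X](scale0r v) ug
  normr0.
rewrite /= ![_ *: v + x]addrC !ug (normrN h) (gtr0_norm h0) ux addr0 [h *: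
  1]mulr1.
have -> : h^-1 *: (g h - g 0) = q by [].
have -> : (- h)^-1 *: (g h - g 0) = - q by rewrite invrN [_ *: _]mulNr.
have := ler_normB (a - q) (- a - q).
have -> : a - q - (- a - q) = a *+ 2 by rewrite mulr2n; ring.
rewrite normrMn mulr2n.
have : `|- a - q| <= `|a - q| + 2 * `|q|.
  have -> : - a - q = (q - a) - 2 * q by ring.
  apply: le_trans (ler_normB _ _) _.
  by rewrite normrM (ger0_norm (ler0n _ 2)) distrC.
have : 2 * `|q| <= `|l - q| + `|l - - q|.
  have := ler_normB (l - - q) (l - q); rewrite (_ : l - - q - (l - q) = 2 *
    q); last by ring.
  by rewrite normrM (ger0_norm (ler0n _ 2)) addrC.
have : 0 < `|a| by rewrite normr_gt0.
lra.
Qed.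

(** * Test functions and integrals with compact support *)

Section test_functions.
Variables (R : realType) (n : nat) (O : set 'rV[R]_n) (phi : 'rV[R]_n -> R).
Hypothesis tphi : test_function O phi.

Lemma test_function_outside x : ~ closure [set x | phi x != 0] x ->
  phi x = 0 /\ forall k, partial k phi x = 0.
Proof.
move=> xK.
have nK : \forall y \near x, phi y = cst 0 y.
  have oK : open (~` closure [set x | phi x != 0]) by apply: closed_openC;
    exact: closed_closure.
  have := open_nbhs_nbhs (conj oK xK); apply: filterS => y yK.
  by apply/eqP; apply: contrapT => /negP y0; apply: yK; exact: subset_closure.
split=> [|k]; first exact: (nbhs_singleton nK).
by rewrite /partial (near_eq_derive _ nK) derive_cst.
Qed.

Lemma test_function_notin x : ~ O x -> phi x = 0 /\ forall k,
  partial k phi x = 0.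
Proof.
by move=> Ox; apply: test_function_outside; have [_ _ KO] := tphi => /KO.
Qed.

Lemma test_function_bounded : exists2 B, 0 <= B & forall x, B < `|x| ->
  phi x = 0 /\ forall k, partial k phi x = 0.
Proof.
have [_ /compact_bounded[B [_ HB]] _] := tphi.
exists (`|B| + 1) => [|x xB]; first by rewrite addr_ge0.
have BB : B < `|B| + 1 by rewrite (le_lt_trans (ler_norm B))// ltrDl.
by apply: test_function_outside => /(HB _ BB) /=; rewrite leNgt xB.
Qed.

Lemma test_function_continuous : continuous phi.
Proof. by have [/(_ 0%N)[]] := tphi. Qed.

Lemma test_function_derivable k x : derivable phi x (delta_mx ord0 k).
Proof. by have [/(_ 1%N)[_ /(_ k)[]]] := tphi. Qed.

Lemma test_function_partial_continuous k : continuous (partial k phi).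
Proof. by have [/(_ 1%N)[_ /(_ k)[_ []]]] := tphi. Qed.

End test_functions.

Section compactly_supported.
Variables (R : realType) (n : nat).
Local Notation mu := (lebesgue_tuple R n).
Local Notation row := (@row_of_tuple R n).

Lemma cube_tuple_notin (B : R) p : ~ cube_tuple R n B p -> B < `|row p|.
Proof.
move=> pB; rewrite ltNge; apply/negP => pB'; apply: pB => j.
rewrite /= in_itv/= -ler_norml; apply: le_trans pB'.
by apply: le_trans (coord_le_norm (row p) j); rewrite mxE.
Qed.

Lemma integrable_compact_support (g : 'rV[R]_n -> R) (B : R) :
  continuous g -> 0 <= B -> (forall x, B < `|x| -> g x = 0) ->
  mu.-integrable setT (EFin \o (g \o row)).
Proof.
move=> cg B0 gB; have [C C0 HC] := continuous_bounded_on_ball cg B0.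
apply: (@integrable_bounded_support _ _ _ mu (cube_tuple R n B) _ C).
- exact: measurable_cube_tuple.
- exact: cube_tuple_ltoo.
- exact: continuous_measurable_row.
- by move=> p /=; have [/HC//|/gB ->] := leP `|row p| B; rewrite normr0.
- by move=> p /cube_tuple_notin; exact: gB.
Qed.

(** The limit may jump where [t] vanishes, so its measurability is part of the conclusion and comes
    from the approximations. *)
Lemma dominated_limit (g_ : nat -> 'rV[R]_n -> R) (g b : 'rV[R]_n -> R) :
  (forall j, continuous (g_ j)) -> (forall x, g_ ^~ x @ \oo --> g x) ->
  (forall j x, `|g_ j x| <= b x) -> mu.-integrable setT (EFin \o (b \o row)) ->
  measurable_fun setT (g \o row) /\
  (\int[mu]_p (g_ j (row p))%:E @[j --> \oo] --> \int[mu]_p (g (row p))%:E)%E.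
Proof.
move=> cg gg gb ib.
have mg_ j : measurable_fun setT (g_ j \o row)
  by exact: continuous_measurable_row.
have mg : measurable_fun setT (g \o row).
  by apply: (measurable_fun_cvg mg_) => p _; exact: gg.
split=> //.
have [] := @dominated_convergence _ _ _ mu setT measurableT
  (fun j p => (g_ j (row p))%:E) (fun p => (g (row p))%:E) (fun p =>
    (b (row p))%:E) => //.
- by move=> j; have /measurable_EFinP := mg_ j.
- by have /measurable_EFinP := mg.
- by apply: aeW => p _; apply: cvg_EFin; [exact: nearW|exact: gg].
- by apply: aeW => p j _; rewrite lee_fin; exact: gb.
Qed.

Lemma hyperplane_null (k : 'I_n) : mu [set p | tnth p k = 0] = 0%E /\
  measurable [set p : n.-tuple (measurableTypeR R) | tnth p k = 0].
Proof.
pose A i : set R := if i == k then [set 0] else setT.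
have mA i : measurable (A i : set (measurableTypeR R)).
  by rewrite /A; case: ifP => _; [exact: measurable_set1|exact: measurableT].
have -> : [set p : n.-tuple (measurableTypeR R) | tnth p k = 0] = box_tuple A.
  apply/seteqP; split=> [p /= pk i|p /(_ k)]; last by rewrite /A eqxx.
  by rewrite /A; case: eqP => // ->.
split; last exact: measurable_box_tuple.
rewrite lebesgue_tuple_box// (bigD1 k)//= {1}/A eqxx lebesgue_measure_set1.
by rewrite mul0e.
Qed.

End compactly_supported.

Lemma profile_bounded (R : realType) (f : R -> R) (M : R) (u0 u1 : R -> R) :
  continuous f -> (forall y : R, 0 <= potential f M y) ->
    potential f M M = 0 -> 0 < M ->
  profile f M u0 u1 ->
  exists C, [/\ 0 <= C, forall y, u1 y <= C & forall y, `|f (u0 y)| <= C].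
Proof.
move=> cf G_ge0 G_M M_gt0 pu0; have [_ _ _ u1_gt0 [u0M _]] := pu0.
have u0M' y : `|u0 y| <= M by have /andP[? ?] := u0M y; rewrite ler_norml !ltW.
have [B1 H1] := continuous_bounded_on_segment cf (ltW M_gt0).
have [B2 H2] := continuous_bounded_on_segment
  (is_derive_continuous (is_derive_potential M cf)) (ltW M_gt0).
have B10 : 0 <= B1 := le_trans (normr_ge0 _) (H1 _ (u0M' 0)).
have B20 : 0 <= B2 := le_trans (normr_ge0 _) (H2 _ (u0M' 0)).
(* This avoids a square root: a value [u1 > 1] satisfies [u1 < u1^2 = 2 G (u0) <= 2 B2]. *)
exists (1 + B1 + 2 * B2); split=> [|y|y].
- lra.
- have E := profile_first_integral cf G_ge0 G_M M_gt0 y pu0.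
  have := H2 _ (u0M' y); rewrite ger0_norm// => H.
  have u1y := u1_gt0 y; rewrite leNgt; apply/negP => lt.
  have : u1 y < u1 y ^+ 2 by rewrite expr2 ltr_pMr//; lra.
  rewrite E; lra.
- by apply: le_trans (H1 _ (u0M' y)) _; lra.
Qed.

(** * The weak inequality for the regularised function and its limit *)

Section supersolution.
Variables (R : realType) (f : R -> R) (M : R) (u0 u1 : R ->
  R) (m : nat) (C : R).
Hypotheses (cf : continuous f) (pu0 : profile f M u0 u1) (m_gt0 : (0 < m)%N).
Hypotheses (C_ge0 : 0 <= C) (u1C : forall y, u1 y <= C) (fC : forall y,
  `|f (u0 y)| <= C).
Local Notation L := (@lshift m m).
Local Notation T := (@rshift m m).
Local Notation mu := (lebesgue_tuple R (m + m)).
Local Notation row := (@row_of_tuple R (m + m)).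
Implicit Types x : 'rV[R]_(m + m).
Let O := [set x : 'rV[R]_(m + m) | t_coord x < s_coord x].
Let v x := u0 ((s_coord x - t_coord x) / Num.sqrt 2).
Variable phi : 'rV[R]_(m + m) -> R.
Hypotheses (tphi : test_function O phi) (phi_ge0 : forall x, 0 <= phi x).

Let flux e x := \sum_k reg_field u1 e k x * partial k phi x.
Let source e x := f (u0 (reg_height e x)) * reg_weight e x * phi x.

Lemma continuous_reg_weight e : 0 < e -> continuous (@reg_weight R m e).
Proof.
move=> e0; apply: continuous_mulE; last exact: continuous_cstE.
by apply: continuous_addE; apply: continuous_sumE => i;
  exact/continuous_sqrE/continuous_reg_dir.
Qed.

Lemma reg_weight_le e x : 0 <= e -> 0 <= reg_weight e x <= m%:R.
Proof.
move=> e0; have H (i_ : 'I_m -> 'I_(m + m)) :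
    0 <= \sum_(i < m) reg_dir i_ e i x ^+ 2 <= m%:R.
  apply/andP; split; first by apply: sumr_ge0 => i _; rewrite sqr_ge0.
  rewrite -[leRHS](_ : \sum_(i < m) 1 = _); last by rewrite sumr_const card_ord.
  apply: ler_sum => i _; rewrite -real_normK ?num_real//.
  by rewrite expr_le1// reg_dir_le1.
have /andP[? ?] := H L; have /andP[? ?] := H T.
rewrite /reg_weight; apply/andP; split; lra.
Qed.

Let fluxC e : 0 < e -> continuous (flux e).
Proof.
move=> e0; apply: continuous_sumE => k; apply: continuous_mulE.
  exact: (continuous_reg_field pu0 e0).
exact: (test_function_partial_continuous tphi).
Qed.

Let sourceC e : 0 < e -> continuous (source e).
Proof.
move=> e0; apply: continuous_mulE; last exact: (test_function_continuous tphi).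
apply: continuous_mulE; first exact: (continuous_f_height cf pu0).
exact: continuous_reg_weight.
Qed.

Let flux0 e x : (forall k, partial k phi x = 0) -> flux e x = 0.
Proof. by move=> H; apply: big1 => k _; rewrite H mulr0. Qed.

Let source0 e x : phi x = 0 -> source e x = 0.
Proof. by move=> H; rewrite /source H mulr0. Qed.

(** The divergence of [phi] times the field has integral 0 and is at most [flux - source]: on [O] by
    the pointwise inequality and [phi >= 0], elsewhere because [phi] vanishes. *)
Lemma regularised_inequality e : 0 < e ->
  (\int[mu]_p (source e (row p))%:E <= \int[mu]_p (flux e (row p))%:E)%E.
Proof.
move=> e0; have [B B0 HB] := test_function_bounded tphi.
have cphi := test_function_continuous tphi.
pose g k x := reg_field u1 e k x * phi x.
pose g' k x := reg_field u1 e k x * partial k phi x + reg_field_deriv f u0 u1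
  e k x * phi x.
have dg k x : is_derive x (delta_mx ord0 k) (g k) (g' k x).
  apply: is_derive_mulE; first exact: (is_derive_reg_field pu0 e0).
  by apply: derivableP; exact: (test_function_derivable tphi).
have pg k : partial k (g k) = g' k by apply/funext => x; have [_ <-] := dg k x.
have cg' k : continuous (g' k).
  apply: continuous_addE; apply: continuous_mulE.
  - exact: (continuous_reg_field pu0 e0).
  - exact: (test_function_partial_continuous tphi).
  - exact: (continuous_reg_field_deriv cf pu0 e0).
  - exact: cphi.
have g'B k x : B < `|x| -> g' k x = 0.
  by move=> /HB[p0 pk0]; rewrite /g' p0 pk0 !mulr0 addr0.
have ig' k : mu.-integrable setT (EFin \o (g' k \o row)).
  by apply: integrable_compact_support B0 _ => //; exact: g'B.
have int0 : (\int[mu]_p (\sum_k g' k (row p))%:E = 0)%E.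
  under eq_integral do rewrite -sumEFin.
  rewrite (@integral_sum _ _ _ mu setT measurableT _ (fun k p =>
    (g' k (row p))%:E)) => [|k].
    apply: big1 => k _; rewrite -pg; apply: (@integral_partial_eq0 _ _ _ _ B)
      => //.
    - by apply: continuous_mulE => //; exact: (continuous_reg_field pu0 e0).
    - by rewrite pg; exact: cg'.
    - by move=> x /HB[p0 _]; rewrite /g p0 mulr0.
    - by move=> x; rewrite pg; exact: g'B.
  exact: ig'.
have iA : mu.-integrable setT (EFin \o (flux e \o row)).
  by apply: integrable_compact_support (fluxC e0) B0 _ => x /HB[_];
    exact: flux0.
have iB : mu.-integrable setT (EFin \o (source e \o row)).
  by apply: integrable_compact_support (sourceC e0) B0 _ => x /HB[+ _];
    exact: source0.
have le x : \sum_k g' k x <= flux e x - source e x.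
  rewrite /g' big_split /= -/(flux e x) lerD2l -mulr_suml /source -mulNr.
  have [Ox|nOx] := pselect (O x); last first.
    by have [-> _] := test_function_notin tphi nOx; rewrite !mulr0.
  by rewrite ler_wpM2r//; exact: (sum_reg_field_deriv_le pu0 m_gt0 e0).
have : (\int[mu]_p (\sum_k g' k (row p))%:E <=
    \int[mu]_p ((flux e (row p))%:E - (source e (row p))%:E))%E.
  apply: le_integral => //.
  - apply: (@integrable_compact_support _ _ (fun x => \sum_k g' k x) _ _ B0).
      exact: continuous_sumE.
    by move=> x xB; apply: big1 => k _; exact: g'B.
  - exact: integrableB.
  - by move=> p _; rewrite -EFinB lee_fin; exact: le.
rewrite int0 integralB_EFin// sube_ge0//.
by apply/orP; left; exact: integrable_fin_num.
Qed.

Lemma cvg_reg_norm (i_ : 'I_m -> 'I_(m + m)) x :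
  (fun j => reg_norm i_ (harmonic j) x) @ \oo --> reg_norm i_ 0 x.
Proof.
rewrite /reg_norm; apply: continuous_cvg; first exact: sqrt_continuous.
by apply: cvgD; [exact: cvg_cst|exact: cvg_harmonic].
Qed.

(** At a zero of the block norm every [reg_dir] vanishes whatever [e] is, so convergence as [e]
    tends to 0 holds at the kinks too. *)
Lemma reg_dir0_eq0 (i_ : 'I_m -> 'I_(m + m)) i x e : reg_norm i_ 0 x = 0 ->
  reg_dir i_ e i x = 0.
Proof.
move=> /eqP; rewrite sqrtr_eq0 addr0 => q0.
suff x0 : x ord0 (i_ i) = 0 by rewrite /reg_dir x0 mul0r.
apply/eqP; rewrite -sqrf_eq0 eq_le sqr_ge0 andbT; apply: le_trans q0.
by rewrite /block_sqnorm (bigD1 i)//= lerDl; apply: sumr_ge0 => j _;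
  rewrite sqr_ge0.
Qed.

Lemma cvg_reg_dir (i_ : 'I_m -> 'I_(m + m)) i x :
  (fun j => reg_dir i_ (harmonic j) i x) @ \oo --> reg_dir i_ 0 i x.
Proof.
have [n0|n0] := eqVneq (reg_norm i_ 0 x) 0.
  rewrite reg_dir0_eq0// (_ : (fun j => _) = fun=> 0); first exact: cvg_cst.
  by apply/funext => j; rewrite reg_dir0_eq0.
apply: cvgM; first exact: cvg_cst.
by apply: cvgV => //; exact: cvg_reg_norm.
Qed.

Lemma cvg_reg_height x :
  (fun j => @reg_height R m (harmonic j) x) @ \oo --> reg_height 0 x.
Proof. by apply: cvgM; [apply: cvgB; exact: cvg_reg_norm|exact: cvg_cst]. Qed.

Lemma cvg_sumE (h : 'I_(m + m) -> nat -> R) (l : 'I_(m + m) -> R) :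
  (forall k, h k @ \oo --> l k) -> (fun j => \sum_k h k j) @ \oo --> \sum_k l k.
Proof.
move=> hl; have -> : (fun j => \sum_k h k j) = \sum_k h k.
  by apply/funext => j; rewrite fct_sumE.
elim/big_ind2 : _ => [|f1 l1 f2 l2 c1 c2|k _];
  [exact: cvg_cst|exact: cvgD|exact: hl].
Qed.

Lemma cvg_reg_field k x :
  (fun j => reg_field u1 (harmonic j) k x) @ \oo --> reg_field u1 0 k x.
Proof.
have [_ du1 _ _ _] := pu0.
have cu : (fun j => (Num.sqrt 2)^-1 * u1 (reg_height (harmonic j) x)) @ \oo -->
    (Num.sqrt 2)^-1 * u1 (reg_height 0 x).
  apply: cvgM; first exact: cvg_cst.
  apply: continuous_cvg; first exact: (is_derive_continuous du1).
  exact: cvg_reg_height.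
rewrite /reg_field; case: (fintype.split k) => i; [|apply: cvgN];
  by apply: cvgM; [exact: cu|exact: cvg_reg_dir].
Qed.

Lemma cvg_flux x : (fun j => flux (harmonic j) x) @ \oo --> flux 0 x.
Proof.
by apply: cvg_sumE => k; apply: cvgM; [exact: cvg_reg_field|exact: cvg_cst].
Qed.

Lemma cvg_source x : (fun j => source (harmonic j) x) @ \oo --> source 0 x.
Proof.
have [du0 _ _ _ _] := pu0.
apply: cvgM; last exact: cvg_cst.
apply: cvgM.
  apply: continuous_cvg; first exact: cf.
  apply: continuous_cvg; first exact: (is_derive_continuous du0).
  exact: cvg_reg_height.
have key (i_ : 'I_m -> 'I_(m + m)) :
   (fun j => \sum_(i < m) reg_dir i_ (harmonic j) i x ^+ 2) @ \oo --> \sum_(i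
     < m) reg_dir i_ 0 i x ^+ 2.
  have -> : (fun j => \sum_(i < m) reg_dir i_ (harmonic j) i x ^+ 2) =
      \sum_(i < m) (fun j => reg_dir i_ (harmonic j) i x ^+ 2).
    by apply/funext => j; rewrite fct_sumE.
  elim/big_ind2 : _ => [|f1 l1 f2 l2 c1 c2|k _]; [exact: cvg_cst|exact: cvgD|].
  rewrite expr2 (_ : (fun j => _) = (fun j =>
    reg_dir i_ (harmonic j) k x * reg_dir i_ (harmonic j) k x)); last first.
    by apply/funext => j; rewrite expr2.
  by apply: cvgM; exact: cvg_reg_dir.
by apply: cvgM; [apply: cvgD; exact: key|exact: cvg_cst].
Qed.

(** The dominating functions do not depend on [e]: the field is bounded by [C] in each component,
    and the weight by [m]. *)
Lemma limit_inequality : [/\ measurable_fun setT (flux 0 \o row),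
  measurable_fun setT (source 0 \o row) &
  (\int[mu]_p (source 0 (row p))%:E <= \int[mu]_p (flux 0 (row p))%:E)%E].
Proof.
have [B B0 HB] := test_function_bounded tphi.
have h0 j : 0 < harmonic j :> R by exact: harmonic_gt0.
have cabs (g : 'rV[R]_(m + m) -> R) : continuous g -> continuous (fun x =>
  `|g x|).
  by apply: continuous_compE => z; exact: norm_continuous.
have [||||mA cA] := @dominated_limit R _ (fun j => flux (harmonic j)) (flux 0)
    (fun x => \sum_k C * `|partial k phi x|).
- by move=> j; exact: fluxC.
- exact: cvg_flux.
- move=> j x; apply: le_trans (ler_norm_sum _ _ _) _; apply: ler_sum => k _.
  by rewrite normrM ler_wpM2r//; exact: (reg_field_le pu0 (ltW (h0 j))).
- apply: integrable_compact_support B0 _.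
    apply: continuous_sumE => k; apply: continuous_mulE;
      first exact: continuous_cstE.
    by apply: cabs; exact: (test_function_partial_continuous tphi).
  by move=> x /HB[_ pk0]; apply: big1 => k _; rewrite pk0 normr0 mulr0.
have [||||mS cS] := @dominated_limit R _ (fun j =>
  source (harmonic j)) (source 0)
    (fun x => C * m%:R * `|phi x|).
- by move=> j; exact: sourceC.
- exact: cvg_source.
- move=> j x; rewrite 2!normrM ler_wpM2r//; apply: ler_pM => //.
  by have /andP[w0 w1] := reg_weight_le x (ltW (h0 j)); rewrite ger0_norm.
- apply: integrable_compact_support B0 _.
    apply: continuous_mulE; first exact: continuous_cstE.
    by apply: cabs; exact: (test_function_continuous tphi).
  by move=> x /HB[p0 _]; rewrite p0 normr0 mulr0.
split=> //; apply: lee_cvg_to cS cA _.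
by apply: nearW => j; exact: regularised_inequality.
Qed.

End supersolution.

(** * The function [u0 ((s - t) / sqrt 2)] itself *)

Section cone_profile.
Variables (R : realType) (f : R -> R) (M : R) (u0 u1 : R -> R) (m : nat).
Hypothesis pu0 : profile f M u0 u1.
Local Notation L := (@lshift m m).
Local Notation T := (@rshift m m).
Implicit Types x : 'rV[R]_(m + m).

Definition cone_profile x : R := u0 ((s_coord x - t_coord x) / Num.sqrt 2).

Lemma reg_norm_s x : reg_norm L 0 x = s_coord x.
Proof. by rewrite /reg_norm addr0. Qed.

Lemma reg_norm_t x : reg_norm T 0 x = t_coord x.
Proof. by rewrite /reg_norm addr0. Qed.

Lemma cone_profileE : cone_profile = fun x => u0 (reg_height 0 x).
Proof. by apply/funext => x; rewrite /reg_height reg_norm_s reg_norm_t. Qed.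

Lemma block_sqnorm_s x : 0 < s_coord x -> 0 < block_sqnorm L x + 0.
Proof. by rewrite addr0 sqrtr_gt0. Qed.

Lemma block_sqnorm_t x : 0 < t_coord x -> 0 < block_sqnorm T x + 0.
Proof. by rewrite addr0 sqrtr_gt0. Qed.

Lemma partial_cone_profile_L x i : 0 < s_coord x ->
  partial (L i) cone_profile x = reg_field u1 0 (L i) x.
Proof.
have [du0 _ _ _ _] := pu0 => /block_sqnorm_s x0; rewrite cone_profileE.
have [_ E] := is_derive_compE (du0 _) (is_derive_reg_height_L i x0).
by rewrite /partial E /reg_field split_lshift; ring.
Qed.

Lemma partial_cone_profile_T x i : 0 < t_coord x ->
  partial (T i) cone_profile x = reg_field u1 0 (T i) x.
Proof.
have [du0 _ _ _ _] := pu0 => /block_sqnorm_t x0; rewrite cone_profileE.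
have [_ E] := is_derive_compE (du0 _) (is_derive_reg_height_T i x0).
by rewrite /partial E /reg_field split_rshift; ring.
Qed.

(** From a point with [t = 0], moving by [h] in a direction of the second block leaves [s] unchanged
    and makes [t = |h|]: a kink, of nonzero slope because [u1 > 0]. *)
Lemma cone_profile_not_derivable x i : t_coord x = 0 ->
  ~ derivable cone_profile x (delta_mx ord0 (T i)).
Proof.
move=> t0; have [du0 _ _ u1_gt0 _] := pu0.
have xT j : x ord0 (T j) = 0.
  apply/eqP; rewrite -sqrf_eq0 eq_le sqr_ge0 andbT.
  move/eqP: t0; rewrite sqrtr_eq0; apply: le_trans.
  by rewrite (bigD1 j)//= lerDl; apply: sumr_ge0 => k _; rewrite sqr_ge0.
pose c : R := (Num.sqrt 2)^-1; have c0 : 0 < c by rewrite invr_gt0 sqrtr_gt0.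
apply: (@abs_kink_not_derivable _ _ _ _ _ (fun h =>
  u0 ((s_coord x - h) * c)) (- (c * u1 (s_coord x * c)))).
- move=> h; rewrite /cone_profile; congr (u0 ((_ - _) / _)).
    congr Num.sqrt; apply: eq_bigr => j _.
    by rewrite !mxE [_ == T i]eq_lrshift mulr0 addr0.
  rewrite -sqrtr_sqr; congr Num.sqrt.
  rewrite (bigD1 i)//= big1 ?addr0 => [|j ji]; rewrite !mxE xT add0r.
    by rewrite !eqxx mulr1.
  by rewrite (inj_eq (@rshift_inj _ _)) (negPf ji) mulr0 expr0n.
- have dl : is_derive (0 : R) 1 (fun h : R => (s_coord x - h) * c) (- c).
    by apply: is_derive_eqE; rewrite /GRing.scale/=; ring.
  apply: is_derive_eqE (is_derive_compE (du0 _) dl); rewrite subr0; ring.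
- by rewrite oppr_eq0 mulf_neq0 ?gt_eqF.
Qed.

Lemma sum_reg_dir0 (i_ : 'I_m -> 'I_(m + m)) x : 0 < reg_norm i_ 0 x ->
  \sum_(i < m) reg_dir i_ 0 i x ^+ 2 = 1.
Proof.
move=> n0; under eq_bigr do rewrite expr_div_n.
have -> : reg_norm i_ 0 x ^+ 2 = block_sqnorm i_ x.
  by rewrite sqr_sqrtr addr0// block_sqnorm_ge0.
rewrite -mulr_suml divff// gt_eqF//.
by move: n0; rewrite sqrtr_gt0 addr0.
Qed.

(** [u0] has slope at most [C], and [s] and [t] are 1-Lipschitz for the Euclidean norm; the factor
    [m + m] passes to the sup norm. *)
Lemma cone_profile_lipschitz C A : (forall y, u1 y <= C) -> 0 <= C ->
  [lipschitz cone_profile x | x in A].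
Proof.
move=> u1C C0; have [du0 _ _ u1_gt0 _] := pu0.
have u0lip a b : `|u0 a - u0 b| <= C * `|a - b|.
  wlog ab : a b / b <= a.
    move=> H; have [/H//|/ltW/H] := leP b a.
    by rewrite distrC [`|b - a|]distrC.
  have [z _ ->] := is_derive_MVT du0 ab.
  by rewrite normrM ler_wpM2r// gtr0_norm.
have lip x y : `|cone_profile x - cone_profile y| <= C * (2 * (m + m)%:R) *
  `|x - y|.
  apply: le_trans (u0lip _ _) _; rewrite -mulrA ler_wpM2l// -mulrBl normrM.
  have c1 : `|(Num.sqrt 2)^-1 : R| <= 1.
    rewrite ger0_norm ?invr_ge0 ?sqrtr_ge0// invf_le1 ?sqrtr_gt0//
      -[leLHS]sqrtr1.
    by apply: ler_wsqrtr; lra.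
  apply: le_trans (_ : `|s_coord x - t_coord x - (s_coord y - t_coord y)| <= _).
    by rewrite ler_piMr.
  have nl : euclid_norm (lsubmx (x - y)) <= euclid_norm (x - y).
    apply: ler_euclid_norm; first exact: euclid_norm_ge0.
    by rewrite sqr_euclid_norm dotr_split lerDl dotr_ge0.
  have nr : euclid_norm (rsubmx (x - y)) <= euclid_norm (x - y).
    apply: ler_euclid_norm; first exact: euclid_norm_ge0.
    by rewrite sqr_euclid_norm dotr_split lerDr dotr_ge0.
  have := euclid_norm_sub_ge (lsubmx x) (lsubmx y).
  have := euclid_norm_sub_ge (rsubmx x) (rsubmx y).
  rewrite -!linearB/= -!s_coordE -!t_coordE => Ht Hs.
  have := ler_normB (s_coord x - s_coord y) (t_coord x - t_coord y).
  have -> : s_coord x - s_coord y - (t_coord x - t_coord y) =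
    s_coord x - t_coord x - (s_coord y - t_coord y) by ring.
  rewrite -s_coordE in nl; rewrite -t_coordE in nr.
  have := euclid_norm_le_norm (x - y); rewrite -[2 * _ * _]mulrA; lra.
rewrite /lipschitz_on; near=> K; move=> [x y] _ /=; apply: le_trans (lip x y) _.
by rewrite ler_wpM2r//; near: K; apply: nbhs_pinfty_ge; exact: num_real.
Unshelve. all: by end_near. Qed.

End cone_profile.

(** * From the limit inequality to the weak formulation *)

Section weak_inequality.
Variables (R : realType) (f : R -> R) (M : R) (u0 u1 : R ->
  R) (m : nat) (C : R).
Hypotheses (cf : continuous f) (pu0 : profile f M u0 u1) (m_gt0 : (0 < m)%N).
Hypotheses (C_ge0 : 0 <= C) (u1C : forall y, u1 y <= C) (fC : forall y,
  `|f (u0 y)| <= C).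
Local Notation T := (@rshift m m).
Local Notation mu := (lebesgue_tuple R (m + m)).
Local Notation row := (@row_of_tuple R (m + m)).
Let O := [set x : 'rV[R]_(m + m) | t_coord x < s_coord x].

Lemma continuous_s_coord : continuous (@s_coord R m).
Proof.
rewrite (_ : @s_coord R m = reg_norm (@lshift m m) 0);
  first exact: continuous_reg_norm.
by apply/funext => x; rewrite reg_norm_s.
Qed.

Lemma continuous_t_coord : continuous (@t_coord R m).
Proof.
rewrite (_ : @t_coord R m = reg_norm (@rshift m m) 0);
  first exact: continuous_reg_norm.
by apply/funext => x; rewrite reg_norm_t.
Qed.

Lemma measurable_cone_side : measurable (row @^-1` O).
Proof.
apply: open_measurable_row.
rewrite (_ : O = (fun x => s_coord x - t_coord x) @^-1` [set y | 0 < y]);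
  last first.
  by apply/seteqP; split=> x; rewrite /O /= subr_gt0.
apply: open_comp; last exact: open_gt.
move=> x _; apply: (continuous_addE continuous_s_coord).
exact: (continuous_oppE continuous_t_coord).
Qed.

Lemma measurable_t_coord0 : measurable [set p | t_coord (row p) = 0].
Proof.
have mt := continuous_measurable_row continuous_t_coord.
rewrite (_ : [set p | _] = setT `&` (@t_coord R m \o row) @^-1` [set 0]).
  by apply: mt => //; exact: measurable_set1.
by rewrite setTI.
Qed.

(** The set [t = 0] lies in a coordinate hyperplane, since the second block has at least one
    coordinate. *)
Lemma ae_t_coord_gt0 : {ae mu, forall p, 0 < t_coord (row p)}.
Proof.
have [N0 mN] := @hyperplane_null R (m + m) (T (Ordinal m_gt0)).
exists [set p | tnth p (T (Ordinal m_gt0)) = 0]; split=> // p /= /negP.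
rewrite -leNgt => t0.
have {t0} : t_coord (row p) = 0 by apply/eqP; rewrite eq_le t0 sqrtr_ge0.
move/eqP; rewrite sqrtr_eq0 => t0; apply/eqP.
rewrite -sqrf_eq0 eq_le sqr_ge0 andbT; apply: le_trans t0.
rewrite (bigD1 (Ordinal m_gt0))//= mxE lerDl.
by apply: sumr_ge0 => k _; rewrite sqr_ge0.
Qed.

(** Passes from [O] to the whole space and ignores the null set [t = 0]. Measurability of [g] on [O]
    is an obligation, the delicate one when [g] contains the gradient of the cone profile. *)
Lemma integral_on_ae (g h : 'rV[R]_(m + m) -> R) :
  measurable_fun (row @^-1` O) (g \o row) -> measurable_fun setT (h \o row) ->
  (forall x, O x -> 0 < t_coord x -> g x = h x) -> (forall x, ~ O x ->
    h x = 0) ->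
  (integral_on O g = \int[mu]_p (h (row p))%:E)%E.
Proof.
move=> mg mh gh h0; rewrite /integral_on.
have mO := measurable_cone_side.
rewrite (@ae_eq_integral _ _ _ mu (row @^-1` O) (fun p => (h (row p))%:E)) //.
- rewrite integral_mkcond; apply: eq_integral => p _; rewrite patchE.
  by case: ifPn => // /negP pO; rewrite h0// => Op; apply: pO; exact: mem_set.
- by have /measurable_EFinP := mg.
- have mh' : measurable_fun (row @^-1` O) (h \o row) by exact: measurable_funTS.
  by have /measurable_EFinP := mh'.
- apply: filterS ae_t_coord_gt0 => p tp Op /=; congr EFin; exact: gh.
Qed.

Lemma cone_profile_weak_supersolution : weak_supersolution f O (@cone_profile
  R u0 m).
Proof.
split.
  move=> x _; exists setT; first exact: filterT.
  exact: (@cone_profile_lipschitz R f M u0 u1 m pu0 C setT u1C C_ge0).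
move=> phi tphi phi_ge0.
have [mF mS le] := limit_inequality cf pu0 m_gt0 u1C fC tphi phi_ge0.
have sgt0 x : O x -> 0 < s_coord x by apply: le_lt_trans; rewrite sqrtr_ge0.
have [du0 _ _ _ _] := pu0.
have cv : continuous (@cone_profile R u0 m).
  rewrite cone_profileE; apply: continuous_compE;
    first exact: (is_derive_continuous du0).
  exact: continuous_reg_height.
rewrite (integral_on_ae _ mS); first last.
- by move=> x Ox; have [-> _] := test_function_notin tphi Ox; rewrite mulr0.
- move=> x Ox tx; rewrite /reg_weight !sum_reg_dir0; last 2 first.
  + by rewrite reg_norm_t.
  + by rewrite reg_norm_s; exact: sgt0.
  by rewrite cone_profileE divff ?mulr1// (_ : 1 + 1 = 2%:R).
- apply: measurable_funTS; apply: continuous_measurable_row.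
  apply: continuous_mulE; last exact: (test_function_continuous tphi).
  by apply: continuous_compE.
rewrite (integral_on_ae _ mF) //; first last.
- by move=> x Ox; have [_ p0] := test_function_notin tphi Ox;
  apply: big1 => k _; rewrite p0 mulr0.
- move=> x Ox tx; rewrite !big_split_ord /=; congr (_ + _);
  apply: eq_bigr => i _.
    by rewrite (partial_cone_profile_L pu0)//; exact: sgt0.
  by rewrite (partial_cone_profile_T pu0).
(* Measurability of the gradient term: where [t = 0] all partial derivatives in the second block
   equal the same default value [pt], so the integrand is that of the field with [e = 0] plus a
   correction carried by [Z]. *)
have [pt Hpt] := derive_not_derivable R.
pose Z := [set p | t_coord (row p) = 0].
pose h p := \sum_k reg_field u1 0 k (row p) * partial k phi (row p) +
  \1_Z p * (pt * \sum_(i < m) partial (T i) phi (row p)).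
apply: (@eq_measurable_fun _ _ _ _ _ h).
  move=> p /set_mem Op; rewrite /h /= !big_split_ord /= -addrA; congr (_ + _).
    by apply: eq_bigr => i _; rewrite (partial_cone_profile_L pu0)//;
      exact: sgt0.
  have [t0|t0] := eqVneq (t_coord (row p)) 0.
    rewrite indicE mem_set// mul1r mulr_sumr -big_split /=;
      apply: eq_bigr => i _.
    rewrite /reg_field split_rshift reg_dir0_eq0 ?reg_norm_t//
      mulr0 oppr0 mul0r add0r.
    congr (_ * _); apply/esym; apply: Hpt.
    exact: (cone_profile_not_derivable pu0).
  rewrite indicE memNset ?mul0r ?addr0; last by move=> /= H;
    rewrite H eqxx in t0.
  apply: eq_bigr => i _; rewrite (partial_cone_profile_T pu0)//.
  by rewrite lt_neqAle eq_sym t0 sqrtr_ge0.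
have mZ : measurable_fun setT (\1_Z : _ -> R) by apply: measurable_indic;
  exact: measurable_t_coord0.
have mT : measurable_fun setT ((fun x =>
  pt * \sum_(i < m) partial (T i) phi x) \o row).
  apply: continuous_measurable_row; apply: continuous_mulE;
    first exact: continuous_cstE.
  by apply: continuous_sumE => i; exact: (test_function_partial_continuous
    tphi).
by apply: measurable_funTS; exact: (measurable_funD mF (measurable_funM mZ mT)).
Qed.

End weak_inequality.

Unset Implicit Arguments.

Theorem proposition1p5 (R : realType) (f : R -> R) (M : R) (u0 : R -> R)
    (m : nat)
    (f_C1 : C1_fun f) (M_gt0 : 0 < M)
    (f_odd : forall y : R, f (- y) = - f y)
    (G_ge0 : forall y : R, 0 <= potential f M y)
    (G_M : potential f M M = 0) (G_NM : potential f M (- M) = 0)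
    (G_gt0 : forall y : R, - M < y < M -> 0 < potential f M y)
    (u0_layer : layer_solution f M u0)
    (m_gt0 : (0 < m)%N) :
  (forall u : 'rV[R]_(m + m) -> R,
     bounded_solution f u ->
     (forall x, simons_cone x -> u x = 0) ->
     forall x : 'rV[R]_(m + m),
       `|u x| <= `|u0 (euclid_dist x simons_cone)| /\
       `|u0 (euclid_dist x simons_cone)| =
         `|u0 ((s_coord x - t_coord x) / Num.sqrt 2)|) /\
  weak_supersolution f [set x : 'rV[R]_(m + m) | t_coord x < s_coord x]
    (fun x => u0 ((s_coord x - t_coord x) / Num.sqrt 2)).
Proof.
have cf := C1_fun_continuous f_C1.
have pu0 := layer_solution_profile u0_layer.
split=> [u solu uC x|].
  split.
    apply: le_trans (ler_norm _).
    exact: (abs_solution_le cf f_odd G_ge0 G_M M_gt0 pu0 m_gt0 solu uC).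
  rewrite euclid_dist_cone//; set d := s_coord x - t_coord x.
  have [d0|d0] := leP 0 d; first by rewrite (ger0_norm d0).
  by rewrite (ltr0_norm d0) mulNr (profile_odd cf f_odd G_ge0 G_M M_gt0 _ pu0)
    normrN.
have [C [C0 u1C fC]] := profile_bounded cf G_ge0 G_M M_gt0 pu0.
exact: (cone_profile_weak_supersolution cf pu0 m_gt0 C0 u1C fC).
Qed.
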